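(* Let $X$ and $Y$ be uniformly locally finite metric spaces and let $\Phi\colon \mathrm{C}^*_u(X)\to \mathrm{C}^*_u(Y)$ be an isomorphism of $\mathrm{C}^*$-algebras. Then $\Phi$ canonically extends to an isomorphism between $\mathrm{C}^*_{ql}(X)$ and $\mathrm{C}^*_{ql}(Y)$; that is, there is a $*$-isomorphism $\tilde\Phi\colon \mathrm{C}^*_{ql}(X)\to \mathrm{C}^*_{ql}(Y)$ whose restriction to $\mathrm{C}^*_u(X)\subseteq \mathrm{C}^*_{ql}(X)$ is $\Phi$.
   Context: A metric space $(X,d)$ is uniformly locally finite (u.l.f.) if balls of a given radius are finite and uniformly bounded in cardinality. For such $X$, $\ell_2(X)$ is the Hilbert space of square-summable functions $X\to\mathbb{C}$ with canonical orthonormal basis $(\delta_x)_{x\in X}$, and $\mathcal{B}(\ell_2(X))$ is the algebra of bounded linear operators on it. **Uniform Roe algebra.** The propagation of $a\in\mathcal{B}(\ell_2(X))$ is $\mathrm{prop}(a)=\sup\{d(x,y): \langle a\delta_x,\delta_y\rangle\ne 0\}\in[0,\infty]$. The uniform Roe algebra $\mathrm{C}^*_u(X)$ is the norm closure in $\mathcal{B}(\ell_2(X))$ of the set of operators of finite propagation. **Quasi-local algebra.** For $A\subseteq X$, $\chi_A$ is the orthogonal projection of $\ell_2(X)$ onto $\ell_2(A)$, and $d(A,B)=\inf\{d(x,y):x\in A,y\in B\}$. The (uniform) quasi-local algebra $\mathrm{C}^*_{ql}(X)$ is the $\mathrm{C}^*$-subalgebra of $\mathcal{B}(\ell_2(X))$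 consisting of all $a$ such that: for every $\varepsilon>0$ there is $r>0$ such that for all $A,B\subseteq X$ with $d(A,B)>r$ one has $\|\chi_A a\chi_B\|\le\varepsilon$. One has $\mathrm{C}^*_u(X)\subseteq \mathrm{C}^*_{ql}(X)$. *)

(* Defs.v *)
From HB Require Import structures.
From mathcomp Require Import all_boot all_order all_algebra.
From mathcomp Require Import all_classical all_reals all_analysis.
From mathcomp Require Import complex ring lra.

Set Implicit Arguments.
Unset Strict Implicit.
Unset Printing Implicit Defensive.

Import Order.TTheory GRing.Theory Num.Theory.
Import Normc.

Local Open Scope classical_set_scope.
Local Open Scope ring_scope.

(* R[i]^o, and not R[i], carries the module structure over the scalars R[i]. *)
Definition sqnorm (R : realType) (X : choiceType) (u : X -> R[i]^o) : \bar R :=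
  \esum_(x in [set: X]) (normc (u x) ^+ 2)%:E.

Definition sqsummable (R : realType) (X : choiceType) : {pred X -> R[i]^o} :=
  fun u => `[< (sqnorm u < +oo)%E >].

Section SqnormTheory.
Context {R : realType} {X : choiceType}.
Implicit Types u v : X -> R[i]^o.

Lemma sqnorm_ge0 u : (0 <= sqnorm u)%E.
Proof. by apply: esum_ge0 => x _; rewrite lee_fin sqr_ge0. Qed.

Lemma normc_ge0 (z : R[i]) : 0 <= normc z.
Proof. by case: z => a b; rewrite sqrtr_ge0. Qed.

Lemma esumZl_le (c : R) (a : X -> \bar R) : 0 <= c ->
  (forall x, 0 <= a x)%E ->
  (\esum_(x in [set: X]) (c%:E * a x) <= c%:E * \esum_(x in [set: X]) a x)%E.
Proof.
move=> c0 a0; apply: ge_ereal_sup => _ [F [finF FX]] <-.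
rewrite -ge0_mule_fsumr//; apply: lee_wpmul2l; first by rewrite lee_fin.
by apply: ereal_sup_ubound; exists F.
Qed.

Lemma sqnormZ_le (c : R[i]) u :
  (sqnorm (c *: u)%R <= (normc c ^+ 2)%R%:E * sqnorm u)%E.
Proof.
apply: le_trans (esumZl_le _ _); last 2 first.
- exact: sqr_ge0.
- by move=> x; rewrite lee_fin sqr_ge0.
by apply: le_esum => x _; rewrite -EFinM -exprMn lee_fin -normcM.
Qed.

Lemma sqnormD_le u v : (sqnorm (u + v)%R <= 2%:E * (sqnorm u + sqnorm v))%E.
Proof.
rewrite /sqnorm -esumD; try by move=> x _; rewrite lee_fin sqr_ge0.
apply: le_trans (esumZl_le _ _) => //; last first.
  by move=> x; rewrite adde_ge0 // lee_fin sqr_ge0.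
apply: le_esum => x _; rewrite -EFinD -EFinM lee_fin.
apply: (@le_trans _ _ ((normc (u x) + normc (v x)) ^+ 2)).
  by rewrite lerXn2r ?nnegrE ?addr_ge0 ?normc_ge0 ?le_normcD.
rewrite -subr_ge0.
set a := normc _; set b := normc _.
rewrite (_ : _ - _ = (a - b) ^+ 2) ?sqr_ge0//.
by rewrite sqrrB sqrrD mulr_natl mulrnDl !mulr2n; ring.
Qed.

Lemma sqsummable_submod_closed : subsemimod_closed (@sqsummable R X).
Proof.
split.
  split.
    apply/asboolP; rewrite /sqnorm esum1 ?ltry// => x _.
    by rewrite normc0 expr0n.
  move=> u v /asboolP u2 /asboolP v2; apply/asboolP.
  apply: le_lt_trans (sqnormD_le u v) _.
  by rewrite lte_mul_pinfty// lte_add_pinfty.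
move=> c u /asboolP u2; apply/asboolP.
apply: le_lt_trans (sqnormZ_le c u) _.
by rewrite lte_mul_pinfty// lee_fin sqr_ge0.
Qed.

End SqnormTheory.

HB.instance Definition _ (R : realType) (X : choiceType) :=
  GRing.isSubmodClosed.Build R[i] (X -> R[i]^o) (@sqsummable R X)
    sqsummable_submod_closed.

Record ell2 (R : realType) (X : choiceType) := Ell2 {
  ell2_fun :> X -> R[i]^o ;
  ell2_funP : ell2_fun \in @sqsummable R X }.

HB.instance Definition _ (R : realType) (X : choiceType) :=
  [isSub for @ell2_fun R X].
HB.instance Definition _ (R : realType) (X : choiceType) :=
  [Choice of ell2 R X by <:].
HB.instance Definition _ (R : realType) (X : choiceType) :=
  [SubChoice_isSubLmodule of ell2 R X by <:].

Definition l2norm (R : realType) (X : choiceType) (u : ell2 R X) : R :=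
  Num.sqrt (fine (sqnorm u)).

Section L2normTheory.
Context {R : realType} {X : choiceType}.
Implicit Types u v : ell2 R X.

Lemma ell2P u v : (forall x, u x = v x) -> u = v.
Proof. by move=> uv; apply: val_inj; apply/funext. Qed.

Lemma sqnorm_fin u : sqnorm u \is a fin_num.
Proof. by rewrite ge0_fin_numE ?sqnorm_ge0//; exact/asboolP/ell2_funP. Qed.

Lemma l2norm_ge0 u : 0 <= l2norm u. Proof. exact: sqrtr_ge0. Qed.

Lemma sqr_l2norm u : (l2norm u ^+ 2)%:E = sqnorm u.
Proof. by rewrite sqr_sqrtr ?fine_ge0 ?sqnorm_ge0// fineK// sqnorm_fin. Qed.

Lemma l2norm_le u (M : R) : 0 <= M ->
  (sqnorm u <= (M ^+ 2)%:E)%E -> l2norm u <= M.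
Proof.
move=> M0; rewrite -sqr_l2norm lee_fin => uM.
by rewrite -(@ler_pXn2r _ 2) ?nnegrE ?l2norm_ge0.
Qed.

Lemma l2norm0 : l2norm (0 : ell2 R X) = 0.
Proof.
apply/eqP; rewrite eq_le l2norm_ge0 andbT l2norm_le// /sqnorm esum1 ?expr0n//.
by move=> x _; rewrite normc0 expr0n.
Qed.

Lemma l2normZ_le (c : R[i]) u : l2norm (c *: u) <= normc c * l2norm u.
Proof.
apply: l2norm_le; first by rewrite mulr_ge0 ?normc_ge0 ?l2norm_ge0.
by rewrite exprMn EFinM sqr_l2norm; exact: sqnormZ_le.
Qed.

Lemma l2normD_le u v : l2norm (u + v) <= 2 * (l2norm u + l2norm v).
Proof.
have [u0 v0] := (l2norm_ge0 u, l2norm_ge0 v).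
apply: l2norm_le; first by rewrite mulr_ge0 ?addr_ge0.
apply: le_trans (sqnormD_le _ _) _.
by rewrite -!sqr_l2norm -EFinD -EFinM lee_fin; nra.
Qed.

End L2normTheory.

(* The inner product is linear in its first argument.  The real and imaginary
   parts of an absolutely summable complex family are summed as differences of
   sums of nonnegative families. *)
Definition rsum (R : realType) (X : choiceType) (f : X -> R) : R :=
  fine (\esum_(x in [set: X]) (Num.max (f x) 0)%:E) -
  fine (\esum_(x in [set: X]) (Num.max (- f x) 0)%:E).

Definition csum (R : realType) (X : choiceType) (f : X -> R[i]) : R[i] :=
  Complex (rsum (fun x => complex.Re (f x))) (rsum (fun x => complex.Im (f x))).

Definition inner (R : realType) (X : choiceType) (u v : ell2 R X) : R[i] :=
  csum (fun x => u x * (v x)^*%C).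

Definition bounded_op (R : realType) (X : choiceType) :
    {pred ell2 R X -> ell2 R X} :=
  fun a => `[< linear a /\ exists M : R, forall u, l2norm (a u) <= M * l2norm u >].

Section BoundedOpTheory.
Context {R : realType} {X : choiceType}.

Lemma bounded_opP (a : ell2 R X -> ell2 R X) : a \in @bounded_op R X ->
  linear a /\ exists2 M : R, 0 <= M & forall u, l2norm (a u) <= M * l2norm u.
Proof.
move=> /asboolP[la [M aM]]; split => //; exists `|M| => // u.
by apply: le_trans (aM u) _; rewrite ler_wpM2r ?l2norm_ge0 ?ler_norm.
Qed.

Lemma bounded_op_submod_closed : subsemimod_closed (@bounded_op R X).
Proof.
split.
  split.
    apply/asboolP; split; first by move=> c u v; rewrite /= scaler0 addr0.
    by exists 0 => u; rewrite l2norm0 mul0r.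
  move=> a b /bounded_opP[la [M M0 aM]] /bounded_opP[lb [N N0 bN]].
  apply/asboolP; split.
    by move=> c u v; rewrite !fctE la lb scalerDr addrACA.
  exists (2 * (M + N)) => u; apply: le_trans (l2normD_le _ _) _.
  by rewrite -mulrA ler_wpM2l// mulrDl lerD.
move=> c a /bounded_opP[la [M M0 aM]]; apply/asboolP; split.
  by move=> d u v; rewrite !fctE la scalerDr !scalerA mulrC.
exists (normc c * M) => u; apply: le_trans (l2normZ_le _ _) _.
by rewrite -mulrA ler_wpM2l ?normc_ge0.
Qed.

Lemma bounded_op_id : idfun \in @bounded_op R X.
Proof. by apply/asboolP; split => //; exists 1 => u; rewrite mul1r. Qed.

Lemma bounded_op_comp (a b : ell2 R X -> ell2 R X) :
  a \in @bounded_op R X -> b \in @bounded_op R X -> a \o b \in @bounded_op R X.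
Proof.
move=> /bounded_opP[la [M M0 aM]] /bounded_opP[lb [N N0 bN]].
apply/asboolP; split; first by move=> c u v; rewrite /= lb la.
exists (M * N) => u; apply: le_trans (aM _) _.
by rewrite -mulrA ler_wpM2l.
Qed.

End BoundedOpTheory.

HB.instance Definition _ (R : realType) (X : choiceType) :=
  GRing.isSubmodClosed.Build R[i] (ell2 R X -> ell2 R X) (@bounded_op R X)
    bounded_op_submod_closed.

Record bop (R : realType) (X : choiceType) := Bop {
  bop_fun :> ell2 R X -> ell2 R X ;
  bop_funP : bop_fun \in @bounded_op R X }.

HB.instance Definition _ (R : realType) (X : choiceType) :=
  [isSub for @bop_fun R X].
HB.instance Definition _ (R : realType) (X : choiceType) :=
  [Choice of bop R X by <:].
HB.instance Definition _ (R : realType) (X : choiceType) :=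
  [SubChoice_isSubLmodule of bop R X by <:].

Section BopRing.
Context {R : realType} {X : choiceType}.
Implicit Types a b c : bop R X.

Definition bop_one : bop R X := Bop bounded_op_id.

Definition bop_mul a b : bop R X :=
  Bop (bounded_op_comp (bop_funP a) (bop_funP b)).

Lemma bopP a b : (forall u, a u = b u) -> a = b.
Proof. by move=> ab; apply: val_inj; apply/funext. Qed.

Lemma bopD a u v : a (u + v) = a u + a v.
Proof.
by have [la _] := bounded_opP (bop_funP a); rewrite -[u]scale1r la !scale1r.
Qed.

Let bop_mulA : associative bop_mul. Proof. by move=> a b c; apply: bopP. Qed.
Let bop_mul1l : left_id bop_one bop_mul. Proof. by move=> a; apply: bopP. Qed.
Let bop_mul1r : right_id bop_one bop_mul. Proof. by move=> a; apply: bopP. Qed.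
Let bop_mulDl : left_distributive bop_mul +%R.
Proof. by move=> a b c; apply: bopP. Qed.
Let bop_mulDr : right_distributive bop_mul +%R.
Proof. by move=> a b c; apply: bopP => u; rewrite /= bopD. Qed.

HB.instance Definition _ := GRing.Zmodule_isPzRing.Build (bop R X)
  bop_mulA bop_mul1l bop_mul1r bop_mulDl bop_mulDr.

End BopRing.

Definition opnorm (R : realType) (X : choiceType) (a : bop R X) : R :=
  sup [set l2norm (a u) | u in [set u | l2norm u <= 1]].

(* By the Riesz representation theorem there is exactly one such operator. *)
Definition adjoint (R : realType) (X : choiceType) (a : bop R X) : bop R X :=
  xget 0 [set b : bop R X | forall u v, inner (a u) v = inner u (b v)].

Section Restriction.
Context {R : realType} {X : choiceType}.

Lemma sqnorm_restrict (A : set X) (u : ell2 R X) :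
  (sqnorm (fun x => if x \in A then u x else 0)%R <= sqnorm u)%E.
Proof.
apply: le_esum => x _; case: ifP => // _.
by rewrite normc0 expr0n lee_fin sqr_ge0.
Qed.

Lemma sqsummable_restrict (A : set X) (u : ell2 R X) :
  (fun x => if x \in A then u x else 0) \in @sqsummable R X.
Proof.
apply/asboolP; apply: le_lt_trans (sqnorm_restrict A u) _.
exact/asboolP/ell2_funP.
Qed.

Lemma bounded_op_restrict (A : set X) :
  (fun u => Ell2 (sqsummable_restrict A u)) \in @bounded_op R X.
Proof.
apply/asboolP; split.
  move=> c u v; apply: ell2P => x /=.
  by rewrite !fctE/=; case: ifP => // _; rewrite scaler0 addr0.
exists 1 => u; rewrite mul1r; apply: l2norm_le; first exact: l2norm_ge0.
by rewrite sqr_l2norm; exact: sqnorm_restrict.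
Qed.

Lemma sqsummable_delta (x : X) :
  (fun y => (y == x)%:R : R[i]^o) \in @sqsummable R X.
Proof.
apply/asboolP; rewrite /sqnorm (esumID [set x]); last first.
  by move=> y _; rewrite lee_fin sqr_ge0.
rewrite setTI esum_set1 ?lee_fin ?sqr_ge0//= esum1 ?adde0 ?ltry// => y [_ /=].
by move=> /eqP/negPf ->; rewrite normc0 expr0n.
Qed.

End Restriction.

Definition chi (R : realType) (X : choiceType) (A : set X) : bop R X :=
  Bop (bounded_op_restrict A).

Definition delta (R : realType) (X : choiceType) (x : X) : ell2 R X :=
  Ell2 (sqsummable_delta x).

Section RoeAlgebras.
Context {R : realType}.

Definition unif_locally_finite (X : metricType R) : Prop :=
  forall r : R, exists n : nat, forall x : X, (ball x r #<= `I_n)%card.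

(* The value 0 accounts for the supremum of the empty set in [0, +oo]. *)
Definition propagation (X : metricType R) (a : bop R X) : \bar R :=
  ereal_sup (0%E |` [set (mdist p.1 p.2)%:E | p in
    [set p : X * X | inner (a (delta R p.1)) (delta R p.2) != 0]]).

Definition setdist (X : metricType R) (A B : set X) : \bar R :=
  ereal_inf [set (mdist p.1 p.2)%:E | p in A `*` B].

Definition uniform_roe (X : metricType R) : set (bop R X) :=
  [set a | forall e : R, 0 < e ->
    exists2 b : bop R X, (propagation b < +oo)%E & opnorm (a - b) <= e].

Definition quasi_local (X : metricType R) : set (bop R X) :=
  [set a | forall e : R, 0 < e -> exists2 r : R, 0 < r &
    forall A B : set X, (r%:E < setdist A B)%E ->
      opnorm (chi R A * a * chi R B) <= e].

(* An operator-valued function on bounded operators whose restriction to the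
   set A is a *-isomorphism onto the set B; its values outside A are
   irrelevant. *)
Definition star_isomorphism (X Y : metricType R) (A : set (bop R X))
    (B : set (bop R Y)) (Phi : bop R X -> bop R Y) : Prop :=
  [/\ set_bij A B Phi,
      forall a b, A a -> A b -> Phi (a + b) = Phi a + Phi b,
      forall (c : R[i]) a, A a -> Phi (c *: a) = c *: Phi a,
      forall a b, A a -> A b -> Phi (a * b) = Phi a * Phi b
    & forall a, A a -> Phi (adjoint a) = adjoint (Phi a)].

End RoeAlgebras.

Arguments uniform_roe {R} X.
Arguments quasi_local {R} X.
Arguments unif_locally_finite {R} X.

(* Main.v *)
Require Import Defs.
From mathcomp Require Import all_boot all_order all_algebra.
From mathcomp Require Import all_classical all_reals all_analysis.
From mathcomp Require Import complex ring lra.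

Set Implicit Arguments.
Unset Strict Implicit.
Unset Printing Implicit Defensive.

Import Order.TTheory GRing.Theory Num.Theory.
Import Normc.

Local Open Scope classical_set_scope.
Local Open Scope ring_scope.

(** The isomorphism is spatial: there is a unitary [U] from [ell2 R X] onto
    [ell2 R Y] with [Phi a = U a U^-1] for all [a] in the uniform Roe algebra
    ([roe_isomorphism_spatial]).  Conjugation by [U] is then the extension, and
    what has to be seen is that it maps quasi-local operators to quasi-local
    operators ([conj_op_quasi_local]); the same statement for [U^-1] gives
    surjectivity.

    Let [a] be quasi-local on [X] and let [A] and [B] be far apart in [Y].
    Bounding [chi_A U a U^-1 chi_B] by the quasi-locality of [a] requires that the
    projections [U^-1 chi_A U] and [U^-1 chi_B U] be essentially supported on
    subsets of [X] that are far apart.  Take a function [f] on [Y] with a small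
    Lipschitz constant which is [1] on [A] and [0] on [B].  Every fixed element of
    the uniform Roe algebra of [Y] almost commutes with [f]
    ([roe_commutes_lip]).  The operators [U chi_S U^-1], for all subsets [S] of
    [X], are such elements, and they almost commute with [f] uniformly in [S]
    ([chi_commutes_lip]): otherwise a gliding hump argument, which uses that
    [U chi_S U^-1] depends on [S] continuously for the strong operator topology,
    assembles a single set [S] for which [roe_commutes_lip] fails.

    So [h = U^-1 f U] almost commutes with all coordinate projections of
    [ell2 R X], which makes it almost diagonal ([almost_diagonal]).  It also
    almost commutes with the operator whose entry is [1] at all pairs of points at
    distance less than a prescribed radius, so its diagonal varies slowly at that
    scale ([diagonal_variation]).  Since [h] is the identity on the range of
    [U^-1 chi_A U] and vanishes on that of [U^-1 chi_B U], these ranges are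
    concentrated where the diagonal of [h] is large and where it is small
    ([fixed_vector_support], [kernel_vector_support]), and these two sets are
    far apart. *)

(** * The inner product of square-summable functions *)

Lemma finite_set_ind (T : choiceType) (P : set T -> Prop) :
  P set0 -> (forall A x, finite_set A -> ~ A x -> P A -> P (x |` A)) ->
  forall A, finite_set A -> P A.
Proof.
move=> P0 PU A /finite_seqP[s ->]; elim: s => [|x s IH].
  by rewrite (_ : [set` [::]] = set0)//; apply/seteqP; split=> y.
have [xs|xs] := boolP (x \in s).
  rewrite (_ : [set` x :: s] = [set` s])//.
  apply/seteqP; split=> y /=; rewrite inE; first by case/predU1P => [->|].
  by move=> ->; rewrite orbT.
rewrite (_ : [set` x :: s] = x |` [set` s]).
  by apply: PU => //; exact/negP.
apply/seteqP; split=> y /=; rewrite inE; first by case/predU1P => [->|]; [left|right].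
by case=> [->|->]; rewrite ?eqxx ?orbT.
Qed.

Section Scalars.
Context {R : realType}.
Implicit Types z w : R[i].

Lemma sqr_normc_ReIm z : normc z ^+ 2 = complex.Re z ^+ 2 + complex.Im z ^+ 2.
Proof. by case: z => a b; rewrite /= sqr_sqrtr ?addr_ge0 ?sqr_ge0. Qed.

Lemma mulc_conj z : z * z^*%C = ((normc z ^+ 2)%:C)%C.
Proof.
rewrite sqr_normc_ReIm; case: z => a b /=; apply/eqP; rewrite eq_complex /=.
by apply/andP; split; apply/eqP; ring.
Qed.

Lemma ReD z w : complex.Re (z + w) = complex.Re z + complex.Re w.
Proof. by case: z w => a b []. Qed.
Lemma ImD z w : complex.Im (z + w) = complex.Im z + complex.Im w.
Proof. by case: z w => a b []. Qed.
Lemma ReN z : complex.Re (- z) = - complex.Re z. Proof. by case: z. Qed.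
Lemma ReM z w : complex.Re (z * w) =
  complex.Re z * complex.Re w - complex.Im z * complex.Im w.
Proof. by case: z w => a b []. Qed.
Lemma ImM z w : complex.Im (z * w) =
  complex.Re z * complex.Im w + complex.Im z * complex.Re w.
Proof. by case: z w => a b []. Qed.
Lemma Re_conj z : complex.Re z^*%C = complex.Re z. Proof. by case: z. Qed.
Lemma Im_conj z : complex.Im z^*%C = - complex.Im z. Proof. by case: z. Qed.
Lemma conjcD z w : (z + w)^*%C = z^*%C + w^*%C. Proof. exact: rmorphD. Qed.
Lemma conjcM z w : (z * w)^*%C = z^*%C * w^*%C. Proof. exact: rmorphM. Qed.
Lemma conjcN z : (- z)^*%C = - z^*%C. Proof. exact: rmorphN. Qed.

Lemma normc_eq0 z : (normc z == 0) = (z == 0).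
Proof. by apply/eqP/eqP => [/eq0_normc//|->]; rewrite normc0. Qed.

Lemma normc_conj z : normc z^*%C = normc z.
Proof. by case: z => a b /=; rewrite sqrrN. Qed.

Lemma normc_real (r : R) : normc (r%:C)%C = `|r|.
Proof. by rewrite /= expr0n addr0 sqrtr_sqr. Qed.

Lemma normc_opp z : normc (- z) = normc z.
Proof. by case: z => a b /=; rewrite !sqrrN. Qed.

End Scalars.

Section Ell2Pointwise.
Context {R : realType} {X : choiceType}.
Implicit Types u v : ell2 R X.

Lemma ell2D u v x : (u + v) x = u x + v x. Proof. by []. Qed.
Lemma ell2Z (c : R[i]) u x : (c *: u) x = c * u x. Proof. by []. Qed.
Lemma ell2N u x : (- u) x = - u x. Proof. by []. Qed.
Lemma ell2B u v x : (u - v) x = u x - v x. Proof. by []. Qed.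
Lemma deltaE (x y : X) : delta R x y = (y == x)%:R. Proof. by []. Qed.
Lemma chiE (A : set X) u x : chi R A u x = if x \in A then u x else 0.
Proof. by []. Qed.

End Ell2Pointwise.

Section InnerProduct.
Context {R : realType} {X : choiceType}.
Implicit Types (f g : X -> R) (u v w : ell2 R X).

Local Notation sum f := (\esum_(x in [set: X]) (f x)%:E).

Definition abs_summable f := (sum (fun x => `|f x|) < +oo)%E.

Lemma le_abs_summable f g : (forall x, `|f x| <= `|g x|) ->
  abs_summable g -> abs_summable f.
Proof.
by move=> fg; apply: le_lt_trans; apply: le_esum => x _; rewrite lee_fin.
Qed.

Lemma abs_summableD f g : abs_summable f -> abs_summable g ->
  abs_summable (fun x => f x + g x).
Proof.
move=> sf sg; apply: (@le_lt_trans _ _ (sum (fun x => `|f x|) + sum (fun x => `|g x|))%E).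
  rewrite -esumD; try by move=> x _; rewrite lee_fin.
  by apply: le_esum => x _; rewrite -EFinD lee_fin ler_normD.
by rewrite lte_add_pinfty.
Qed.

Lemma abs_summableZ (c : R) f : abs_summable f -> abs_summable (fun x => c * f x).
Proof.
move=> sf; apply: (@le_lt_trans _ _ (`|c|%:E * sum (fun x => `|f x|))%E).
  apply: le_trans (esumZl_le _ _) => //.
  by apply: le_esum => x _; rewrite -EFinM lee_fin normrM.
by rewrite lte_mul_pinfty// lee_fin.
Qed.

Lemma nneg_sum_fin f : (forall x, 0 <= f x) -> abs_summable f ->
  sum f \is a fin_num.
Proof.
move=> f0 sf; rewrite ge0_fin_numE; last by apply: esum_ge0 => x _; rewrite lee_fin.
by apply: le_lt_trans sf; apply: le_esum => x _; rewrite lee_fin ler_norm.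
Qed.

(** Both splittings of [f] satisfy [f^+ + b = a + f^-], and sums of nonnegative
    families are additive.  Linearity of [rsum] reduces to this, as
    positive parts do not commute with addition. *)
Lemma rsum_split f a b : (forall x, 0 <= a x) -> (forall x, 0 <= b x) ->
  abs_summable a -> abs_summable b -> (forall x, f x = a x - b x) ->
  rsum f = fine (sum a) - fine (sum b).
Proof.
move=> a0 b0 sa sb fE.
have p0 x : 0 <= Num.max (f x) 0 by rewrite le_max lexx orbT.
have n0 x : 0 <= Num.max (- f x) 0 by rewrite le_max lexx orbT.
have sp : abs_summable (fun x => Num.max (f x) 0).
  apply: le_abs_summable sa => x; rewrite !ger0_norm// fE.
  by rewrite ge_max a0 andbT lerBlDr lerDl.
have sn : abs_summable (fun x => Num.max (- f x) 0).
  apply: le_abs_summable sb => x; rewrite !ger0_norm// fE.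
  by rewrite ge_max b0 andbT opprB lerBlDr lerDl.
have /(congr1 fine) : (sum (fun x => Num.max (f x) 0)%R + sum b =
        sum (fun x => Num.max (- f x) 0)%R + sum a)%E.
  rewrite -!esumD; try by move=> x _; rewrite lee_fin.
  apply: eq_esum => x _; rewrite -!EFinD; congr EFin; rewrite fE.
  by case: (leP (a x - b x) 0); case: (leP (- (a x - b x)) 0); lra.
rewrite !fineD ?nneg_sum_fin// /rsum; lra.
Qed.

Lemma nneg_rsum f : (forall x, 0 <= f x) -> abs_summable f ->
  rsum f = fine (sum f).
Proof.
move=> f0 sf; rewrite (@rsum_split f f (fun=> 0))//; last by move=> x; rewrite subr0.
  by rewrite [X in _ - fine X]esum1 ?subr0.
by rewrite /abs_summable esum1 ?ltry// => x _; rewrite normr0.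
Qed.

Lemma posneg_parts f : abs_summable f -> exists a b : X -> R,
  [/\ forall x, 0 <= a x, forall x, 0 <= b x, abs_summable a, abs_summable b
    & forall x, f x = a x - b x].
Proof.
move=> sf; exists (fun x => Num.max (f x) 0), (fun x => Num.max (- f x) 0).
split; try by move=> x; rewrite le_max lexx orbT.
- apply: le_abs_summable sf => x; rewrite ger0_norm ?le_max ?lexx ?orbT//.
  by rewrite ge_max normr_ge0 ler_norm.
- apply: le_abs_summable sf => x; rewrite ger0_norm ?le_max ?lexx ?orbT//.
  by rewrite ge_max normr_ge0 -normrN ler_norm.
- by move=> x; case: (leP (f x) 0); case: (leP (- f x) 0); lra.
Qed.

Lemma rsumD f g : abs_summable f -> abs_summable g ->
  rsum (fun x => f x + g x) = rsum f + rsum g.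
Proof.
move=> /posneg_parts[a [b [a0 b0 sa sb fE]]] /posneg_parts[c [d [c0 d0 sc sd gE]]].
rewrite (@rsum_split f a b)// (@rsum_split g c d)//.
rewrite (@rsum_split _ (fun x => a x + c x) (fun x => b x + d x)); first last.
- by move=> x; rewrite fE gE; lra.
- exact: abs_summableD.
- exact: abs_summableD.
- by move=> x; rewrite addr_ge0.
- by move=> x; rewrite addr_ge0.
have esD (h k : X -> R) : (forall x, 0 <= h x) -> (forall x, 0 <= k x) ->
    abs_summable h -> abs_summable k ->
    fine (sum (fun x => h x + k x)) = fine (sum h) + fine (sum k).
  move=> h0 k0 sh sk; rewrite -fineD ?nneg_sum_fin// -esumD//;
  by move=> x _; rewrite lee_fin.
by rewrite (esD a c)// (esD b d)//; lra.
Qed.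

Lemma rsumN f : abs_summable f -> rsum (fun x => - f x) = - rsum f.
Proof.
move=> /posneg_parts[a [b [a0 b0 sa sb fE]]].
rewrite (@rsum_split f a b)// (@rsum_split _ b a)//; first by lra.
by move=> x; rewrite fE; lra.
Qed.

Lemma esum_scale (c : R) f : 0 <= c -> (forall x, 0 <= f x) ->
  sum (fun x => c * f x) = (c%:E * sum f)%E.
Proof.
move=> c0 f0; have [->|cn0] := eqVneq c 0.
  by rewrite mul0e esum1// => x _; rewrite mul0r.
apply/eqP; rewrite eq_le; apply/andP; split.
  by apply: le_trans (esumZl_le _ _) => //; apply: le_esum.
have -> : sum f = sum (fun x => c^-1 * (c * f x)).
  by apply: eq_esum => x _; rewrite mulKf.
rewrite -[leRHS]mul1e -(@divff _ c)// EFinM -muleA.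
rewrite lee_wpmul2l//; apply: (@le_trans _ _ (\esum_(x in [set: X]) (c^-1%:E * (c * f x)%:E))%E).
  by apply: le_esum.
by apply: esumZl_le; rewrite ?invr_ge0// => x; rewrite lee_fin mulr_ge0.
Qed.

Lemma rsumZ (c : R) f : abs_summable f -> rsum (fun x => c * f x) = c * rsum f.
Proof.
have pos (d : R) : 0 <= d -> abs_summable f -> rsum (fun x => d * f x) = d * rsum f.
  move=> d0 /posneg_parts[a [b [a0 b0 sa sb fE]]].
  rewrite (@rsum_split f a b)//.
  rewrite (@rsum_split _ (fun x => d * a x) (fun x => d * b x)); first last.
  - by move=> x; rewrite fE; lra.
  - exact: abs_summableZ.
  - exact: abs_summableZ.
  - by move=> x; rewrite mulr_ge0.
  - by move=> x; rewrite mulr_ge0.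
  by rewrite !esum_scale// !fineM ?nneg_sum_fin//= mulrBr.
move=> sf; have [c0|c0] := leP 0 c; first exact: pos.
rewrite (_ : (fun x => _) = (fun x => - (- c * f x))); last first.
  by apply/funext => x; lra.
by rewrite rsumN ?pos//; [lra|rewrite oppr_ge0 ltW|exact: abs_summableZ].
Qed.

Lemma sqnorm_abs u : abs_summable (fun x => normc (u x) ^+ 2).
Proof.
have := sqnorm_fin u; rewrite ge0_fin_numE ?sqnorm_ge0//; apply: le_lt_trans.
by apply: le_esum => x _; rewrite ger0_norm ?sqr_ge0.
Qed.

Lemma inner_summable u v :
  abs_summable (fun x => complex.Re (u x * (v x)^*%C)) /\
  abs_summable (fun x => complex.Im (u x * (v x)^*%C)).
Proof.
have le x : normc (u x * (v x)^*%C) <= normc (u x) ^+ 2 + normc (v x) ^+ 2.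
  rewrite normcM normc_conj.
  by have := normc_ge0 (u x); have := normc_ge0 (v x); nra.
have sD := abs_summableD (sqnorm_abs u) (sqnorm_abs v).
split; apply: le_abs_summable sD => x; rewrite [leRHS]ger0_norm ?addr_ge0 ?sqr_ge0//;
  apply: le_trans (le x); rewrite -(@ler_pXn2r _ 2)//= ?nnegrE ?normc_ge0//;
  by rewrite real_normK ?num_real// sqr_normc_ReIm ?lerDl ?lerDr sqr_ge0.
Qed.

Lemma complex_eq (a b : R[i]) :
  complex.Re a = complex.Re b -> complex.Im a = complex.Im b -> a = b.
Proof. by case: a b => a1 a2 [b1 b2] /= -> ->. Qed.

Lemma Re_inner u v :
  complex.Re (inner u v) = rsum (fun x => complex.Re (u x * (v x)^*%C)).
Proof. by []. Qed.

Lemma Im_inner u v :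
  complex.Im (inner u v) = rsum (fun x => complex.Im (u x * (v x)^*%C)).
Proof. by []. Qed.

Lemma innerDl u v w : inner (u + v) w = inner u w + inner v w.
Proof.
have [r1 i1] := inner_summable u w; have [r2 i2] := inner_summable v w.
apply: complex_eq.
  rewrite ReD !Re_inner -(rsumD r1 r2); congr rsum; apply/funext => x.
  by rewrite ell2D mulrDl ReD.
rewrite ImD !Im_inner -(rsumD i1 i2); congr rsum; apply/funext => x.
by rewrite ell2D mulrDl ImD.
Qed.

Lemma innerZl (c : R[i]) u w : inner (c *: u) w = c * inner u w.
Proof.
have [r1 i1] := inner_summable u w.
apply: complex_eq.
  rewrite ReM !Re_inner Im_inner -(rsumZ _ r1) -(rsumZ _ i1).
  rewrite -(rsumN (abs_summableZ _ i1)).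
  rewrite -(rsumD (abs_summableZ _ r1)); last first.
    by apply: le_abs_summable (abs_summableZ (complex.Im c) i1) => x; rewrite normrN.
  by congr rsum; apply/funext => x; rewrite ell2Z -mulrA ReM.
rewrite ImM Re_inner !Im_inner -(rsumZ _ r1) -(rsumZ _ i1).
rewrite -(rsumD (abs_summableZ _ i1) (abs_summableZ _ r1)).
by congr rsum; apply/funext => x; rewrite ell2Z -mulrA ImM.
Qed.

Lemma innerC u v : inner v u = (inner u v)^*%C.
Proof.
have [r1 i1] := inner_summable u v.
apply: complex_eq.
  rewrite Re_conj !Re_inner; congr rsum; apply/funext => x.
  by case: (u x) => a b; case: (v x) => c d /=; lra.
rewrite Im_conj !Im_inner -(rsumN i1); congr rsum; apply/funext => x.
by case: (u x) => a b; case: (v x) => c d /=; lra.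
Qed.

Lemma innerDr u v w : inner w (u + v) = inner w u + inner w v.
Proof. by rewrite (innerC (u + v)) innerDl conjcD (innerC u w) (innerC v w). Qed.

Lemma innerZr (c : R[i]) u w : inner w (c *: u) = c^*%C * inner w u.
Proof. by rewrite (innerC (c *: u)) innerZl conjcM (innerC u w). Qed.

Lemma inner0l u : inner 0 u = 0.
Proof. by rewrite -(scale0r 0) innerZl mul0r. Qed.

Lemma inner0r u : inner u 0 = 0.
Proof. by rewrite innerC inner0l conjc0. Qed.

Lemma innerNl u w : inner (- u) w = - inner u w.
Proof. by rewrite -scaleN1r innerZl mulN1r. Qed.

Lemma innerNr u w : inner w (- u) = - inner w u.
Proof. by rewrite (innerC (- u)) innerNl conjcN (innerC u w). Qed.

Lemma innerxx u : inner u u = ((l2norm u ^+ 2)%:C)%C.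
Proof.
apply: complex_eq.
  rewrite Re_inner (_ : rsum _ = rsum (fun x => normc (u x) ^+ 2)); last first.
    by congr rsum; apply/funext => x; rewrite mulc_conj.
  rewrite nneg_rsum; [|by move=> x; rewrite sqr_ge0|exact: sqnorm_abs].
  by rewrite -/(sqnorm u) -sqr_l2norm.
rewrite Im_inner (_ : rsum _ = rsum (fun _ : X => 0)); last first.
  by congr rsum; apply/funext => x; rewrite mulc_conj.
by rewrite nneg_rsum// ?esum1// /abs_summable esum1 ?ltry// => x _; rewrite normr0.
Qed.

Lemma normc_le_l2norm u x : normc (u x) <= l2norm u.
Proof.
rewrite -(@ler_pXn2r _ 2)//= ?nnegrE ?normc_ge0 ?l2norm_ge0//.
rewrite -lee_fin sqr_l2norm; apply: esum_ge; exists [set x]; first by split.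
by rewrite fsbig_set1.
Qed.

Lemma l2norm_eq0 u : l2norm u = 0 -> u = 0.
Proof.
move=> u0; apply: ell2P => x; apply: eq0_normc; apply/eqP.
by rewrite eq_le normc_ge0 andbT -u0 normc_le_l2norm.
Qed.

Lemma sqr_l2normD u v : l2norm (u + v) ^+ 2 =
  l2norm u ^+ 2 + l2norm v ^+ 2 + 2 * complex.Re (inner u v).
Proof.
have /(congr1 (@complex.Re R)) := innerxx (u + v).
rewrite innerDl !innerDr !innerxx (innerC u v) !raddfD /=.
by case: (inner u v) => a b /= <-; lra.
Qed.

Lemma l2normZ (c : R[i]) u : l2norm (c *: u) = normc c * l2norm u.
Proof.
have /(congr1 (@complex.Re R)) := innerxx (c *: u).
rewrite innerZl innerZr mulrA mulc_conj innerxx /= => /esym /eqP.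
rewrite mul0r subr0 -exprMn eqrXn2 ?mulr_ge0 ?normc_ge0 ?l2norm_ge0//.
by move/eqP.
Qed.

Lemma l2normN u : l2norm (- u) = l2norm u.
Proof. by rewrite -scaleN1r l2normZ normc_opp normc1 mul1r. Qed.

Lemma parallelogram u v : l2norm (u + v) ^+ 2 + l2norm (u - v) ^+ 2 =
  2 * (l2norm u ^+ 2 + l2norm v ^+ 2).
Proof.
rewrite (sqr_l2normD u v) (sqr_l2normD u (- v)) innerNr l2normN ReN; lra.
Qed.

(** The squared norm of [l2norm v *: u - l2norm u *: v] is nonnegative. *)
Lemma Re_inner_le u v : complex.Re (inner u v) <= l2norm u * l2norm v.
Proof.
have [u0|u0] := eqVneq (l2norm u) 0.
  by rewrite (l2norm_eq0 u0) inner0l l2norm0 mul0r.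
have [v0|v0] := eqVneq (l2norm v) 0.
  by rewrite (l2norm_eq0 v0) inner0r l2norm0 mulr0.
have up : 0 < l2norm u by rewrite lt_neqAle eq_sym u0 l2norm_ge0.
have vp : 0 < l2norm v by rewrite lt_neqAle eq_sym v0 l2norm_ge0.
set a := l2norm u in up *; set b := l2norm v in vp *.
have := sqr_ge0 (l2norm ((b%:C)%C *: u + ((- a)%:C)%C *: v)).
rewrite sqr_l2normD !l2normZ !normc_real innerZl innerZr normrN !gtr0_norm// -/a -/b.
case: (inner u v) => s t /=; set ab := a * b => H.
have ab0 : 0 < ab by rewrite mulr_gt0.
have {}H : 0 <= 2 * ab * (ab - s) by rewrite (le_trans H)// /ab; lra.
by rewrite pmulr_rge0 ?subr_ge0// ?mulr_gt0 in H.
Qed.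

(** Multiplying [u] by the conjugate of [inner u v] makes the inner product
    real and nonnegative, which reduces the modulus to the real part. *)
Lemma CauchySchwarz u v : normc (inner u v) <= l2norm u * l2norm v.
Proof.
have [->|z0] := eqVneq (inner u v) 0.
  by rewrite normc0 mulr_ge0 ?l2norm_ge0.
have n0 : 0 < normc (inner u v).
  by rewrite lt_neqAle normc_ge0 andbT eq_sym normc_eq0.
have := Re_inner_le ((inner u v)^*%C *: u) v.
rewrite l2normZ innerZl mulrC mulc_conj normc_conj /= expr2 -mulrA.
by rewrite ler_pM2l.
Qed.

Lemma sqr_CauchySchwarz u v :
  normc (inner u v) ^+ 2 <= l2norm u ^+ 2 * l2norm v ^+ 2.
Proof.
by rewrite -exprMn lerXn2r ?nnegrE ?normc_ge0 ?mulr_ge0 ?l2norm_ge0 ?CauchySchwarz.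
Qed.

Lemma ler_l2normD u v : l2norm (u + v) <= l2norm u + l2norm v.
Proof.
rewrite -(@ler_pXn2r _ 2)//= ?nnegrE ?addr_ge0 ?l2norm_ge0//.
by rewrite sqr_l2normD; have := Re_inner_le u v; lra.
Qed.

Lemma ler_l2normB u v : l2norm (u - v) <= l2norm u + l2norm v.
Proof. by rewrite -(l2normN v) ler_l2normD. Qed.

Lemma sqnorm_supp1 (x : X) (u : X -> R[i]^o) :
  (forall y, y != x -> u y = 0) -> sqnorm u = (normc (u x) ^+ 2)%:E.
Proof.
move=> ux; rewrite /sqnorm (esumID [set x]); last first.
  by move=> y _; rewrite lee_fin sqr_ge0.
rewrite setTI esum_set1 ?lee_fin ?sqr_ge0//= esum1 ?adde0// => y [_ /= /eqP yx].
by rewrite ux// normc0 expr0n.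
Qed.

Lemma l2norm_delta (x : X) : l2norm (delta R x) = 1.
Proof.
rewrite /l2norm (@sqnorm_supp1 x) /=; last by move=> y /negPf ->.
by rewrite eqxx normc1 expr1n sqrtr1.
Qed.

Lemma inner_delta u x : inner u (delta R x) = u x.
Proof.
have supp1 (f : X -> R) : (forall y, y != x -> f y = 0) -> rsum f = f x.
  move=> fx; rewrite /rsum.
  have s1 (h : X -> R) : 0 <= h x -> (forall y, y != x -> h y = 0) -> fine (sum h) = h x.
    move=> h0 hx; rewrite (esumID [set x]); last first.
      by move=> y _; rewrite lee_fin; have [->|/hx ->] := eqVneq y x.
    rewrite setTI esum_set1 ?lee_fin//= esum1 ?adde0// => y [_ /= /eqP yx].
    by rewrite hx.
  rewrite (s1 (fun y => Num.max (f y) 0)) ?(s1 (fun y => Num.max (- f y) 0)).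
  - by case: (leP (f x) 0); case: (leP (- f x) 0); lra.
  - by rewrite le_max lexx orbT.
  - by move=> y /fx ->; rewrite oppr0 maxxx.
  - by rewrite le_max lexx orbT.
  - by move=> y /fx ->; rewrite maxxx.
have dE y : (delta R x y)^*%C = (y == x)%:R.
  by rewrite deltaE; case: (y == x); [exact: conjc1|exact: conjc0].
apply: complex_eq; rewrite ?Re_inner ?Im_inner supp1.
- by rewrite dE eqxx mulr1.
- by move=> y /negPf yx; rewrite dE yx mulr0.
- by rewrite dE eqxx mulr1.
- by move=> y /negPf yx; rewrite dE yx mulr0.
Qed.

End InnerProduct.

(** * Bounded operators and their adjoints *)

Section Operators.
Context {R : realType} {X : choiceType}.
Implicit Types (a b c : bop R X) (u v w : ell2 R X) (A B K : set X).

Lemma bopDE a b u : (a + b) u = a u + b u. Proof. by []. Qed.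
Lemma bopBE a b u : (a - b) u = a u - b u. Proof. by []. Qed.
Lemma bopZE (z : R[i]) a u : (z *: a) u = z *: a u. Proof. by []. Qed.
Lemma bopME a b u : (a * b) u = a (b u). Proof. by []. Qed.
Lemma bop0E u : (0 : bop R X) u = 0. Proof. by []. Qed.

Lemma bop0 a : a 0 = 0.
Proof. by apply: (addrI (a 0)); rewrite -bopD !addr0. Qed.

Lemma bopZ a (z : R[i]) u : a (z *: u) = z *: a u.
Proof.
have [la _] := bounded_opP (bop_funP a).
by have := la z u 0; rewrite !addr0 -/(bop_fun a 0) bop0 addr0.
Qed.

Lemma bopN a u : a (- u) = - a u.
Proof. by rewrite -scaleN1r bopZ scaleN1r. Qed.

Lemma bopB a u v : a (u - v) = a u - a v.
Proof. by rewrite bopD bopN. Qed.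

Lemma bop_bounded a : exists2 M : R, 0 <= M & forall u, l2norm (a u) <= M * l2norm u.
Proof. by have [] := bounded_opP (bop_funP a). Qed.

Lemma l2norm_bop_le a u : l2norm (a u) <= opnorm a * l2norm u.
Proof.
have [M M0 aM] := bop_bounded a.
have [->|u0] := eqVneq u 0; first by rewrite bop0 l2norm0 mulr0.
have nu : 0 < l2norm u.
  by rewrite lt_neqAle l2norm_ge0 andbT eq_sym; apply: contra u0 => /eqP/l2norm_eq0 ->.
rewrite -ler_pdivrMr// mulrC.
have -> : (l2norm u)^-1 * l2norm (a u) = l2norm (a (((l2norm u)^-1)%:C%C *: u)).
  by rewrite bopZ l2normZ normc_real ger0_norm// invr_ge0 ltW.
apply: ub_le_sup.
  exists M => _ [v /= v1 <-]; apply: le_trans (aM v) _.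
  by rewrite -[leRHS]mulr1 ler_wpM2l.
exists (((l2norm u)^-1)%:C%C *: u) => //=.
by rewrite l2normZ normc_real ger0_norm ?invr_ge0 ?l2norm_ge0// mulVf// gt_eqF.
Qed.

Lemma opnorm_ge0 a : 0 <= opnorm a.
Proof.
have [[u u0]|nu] := pselect (exists u, 0 < l2norm u).
  by have := le_trans (l2norm_ge0 _) (l2norm_bop_le a u); rewrite pmulr_lge0.
have u0 u : u = 0.
  apply: l2norm_eq0; apply/eqP; rewrite eq_le l2norm_ge0 andbT leNgt.
  by apply/negP => h; apply: nu; exists u.
rewrite /opnorm (_ : [set _ | _ in _] = [set 0]) ?sup1//.
apply/seteqP; split=> [_ [u _ <-]/=|_ ->]; first by rewrite (u0 (a u)) l2norm0.
by exists 0 => /=; rewrite ?bop0 l2norm0.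
Qed.

Lemma opnorm_le a (M : R) : 0 <= M ->
  (forall u, l2norm (a u) <= M * l2norm u) -> opnorm a <= M.
Proof.
move=> M0 aM; apply: ge_sup.
  by exists (l2norm (a 0)); exists 0 => //=; rewrite l2norm0.
move=> _ [v /= v1 <-]; apply: le_trans (aM v) _.
by rewrite -[leRHS]mulr1 ler_wpM2l.
Qed.

Lemma opnorm_leP a (M : R) : 0 <= M ->
  (opnorm a <= M <-> forall u, l2norm (a u) <= M * l2norm u).
Proof.
move=> M0; split=> [aM u|]; last exact: opnorm_le.
by apply: le_trans (l2norm_bop_le a u) _; rewrite ler_wpM2r// l2norm_ge0.
Qed.

Lemma normc_entry_le a u x : normc (a u x) <= opnorm a * l2norm u.
Proof. exact: le_trans (normc_le_l2norm _ _) (l2norm_bop_le _ _). Qed.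

Lemma l2norm_chi_le A u : l2norm (chi R A u) <= l2norm u.
Proof. by apply: l2norm_le; rewrite ?l2norm_ge0// sqr_l2norm; exact: sqnorm_restrict. Qed.

Lemma chi_chi A B u : chi R A (chi R B u) = chi R (A `&` B) u.
Proof.
by apply: ell2P => x; rewrite !chiE in_setI; case: (x \in A); case: (x \in B).
Qed.

Lemma chiD_compl A u : chi R A u + chi R (~` A) u = u.
Proof.
by apply: ell2P => x; rewrite ell2D !chiE in_setC; case: (x \in A); rewrite ?addr0 ?add0r.
Qed.

Lemma sqr_l2norm_disj u v : (forall x, u x = 0 \/ v x = 0) ->
  l2norm (u + v) ^+ 2 = l2norm u ^+ 2 + l2norm v ^+ 2.
Proof.
move=> uv; apply: EFin_inj; rewrite EFinD !sqr_l2norm /sqnorm -esumD;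
  try by move=> x _; rewrite lee_fin sqr_ge0.
apply: eq_esum => x _; rewrite ell2D -EFinD; congr EFin.
by have [->|->] := uv x; rewrite normc0 expr0n/= ?(add0r, addr0).
Qed.

Lemma chi_set0 u : chi R set0 u = 0.
Proof. by apply: ell2P => x; rewrite chiE in_set0. Qed.

Lemma chi_setU1 A x u : ~ A x -> chi R (x |` A) u = chi R A u + u x *: delta R x.
Proof.
move=> Ax; apply: ell2P => y; rewrite ell2D ell2Z deltaE !chiE in_setU in_set1.
have [->|yx] := eqVneq y x; last by rewrite /= mulr0 addr0.
by rewrite (memNset Ax) mulr1 add0r.
Qed.

Lemma chi_delta A x : chi R A (delta R x) = if x \in A then delta R x else 0.
Proof.
apply: ell2P => y; rewrite chiE deltaE; have [->|yx] := eqVneq y x.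
  by case: ifP => _; rewrite ?deltaE ?eqxx.
by rewrite if_same; case: ifP => _; rewrite ?deltaE ?(negPf yx).
Qed.

(** The finite set nearly attains the supremum that defines [sqnorm u]. *)
Lemma chi_tail u (e : R) : 0 < e ->
  exists2 K, finite_set K & l2norm (chi R (~` K) u) <= e.
Proof.
move=> e0.
have ufin : (\esum_(x in [set: X]) (normc (u x) ^+ 2)%:E)%E \is a fin_num.
  exact: sqnorm_fin.
have [_ [K [finK _] <-] ltK] := ub_ereal_sup_adherent (exprn_gt0 2 e0) ufin.
exists K => //; rewrite -(@ler_pXn2r _ 2)//= ?nnegrE ?l2norm_ge0// ?ltW//.
have := sqr_l2norm_disj (u := chi R K u) (v := chi R (~` K) u).
rewrite chiD_compl => /(_ _)/wrap[] ; first last.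
  move=> sq; move: ltK; rewrite -/(esum _ _) -/(sqnorm u) -sqr_l2norm sq.
  have -> : (\sum_(x \in K) (normc (u x) ^+ 2)%:E)%E = (l2norm (chi R K u) ^+ 2)%:E.
    rewrite sqr_l2norm /sqnorm -esum_fset//; last by move=> x _; rewrite lee_fin sqr_ge0.
    rewrite esum_mkcond; apply: eq_esum => x _; rewrite chiE.
    by case: ifP; rewrite ?normc0 ?expr0n.
  by rewrite -EFinB lte_fin; lra.
by move=> x; rewrite !chiE in_setC; case: (x \in K); [right|left].
Qed.

(** Such a functional vanishes on finitely supported vectors, and the rest of a
    vector is small by [chi_tail]. *)
Lemma bounded_functional_eq0 (phi : ell2 R X -> R[i]) (M : R) :
  (forall u v, phi (u + v) = phi u + phi v) ->
  (forall z u, phi (z *: u) = z * phi u) ->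
  (forall u, normc (phi u) <= M * l2norm u) ->
  (forall x, phi (delta R x) = 0) -> forall u, phi u = 0.
Proof.
move=> phiD phiZ phiM phid u; apply: eq0_normc; apply/eqP.
rewrite eq_le normc_ge0 andbT; apply/ler_addgt0Pl => e e0; rewrite addr0.
have M1 : 0 < `|M| + 1 by rewrite ltr_pwDr.
have [K finK Ke] := chi_tail u (divr_gt0 e0 M1).
rewrite -(chiD_compl K u) phiD (_ : phi (chi R K u) = 0) ?add0r.
  apply: le_trans (phiM _) _; apply: (@le_trans _ _ ((`|M| + 1) * (e / (`|M| + 1)))).
    apply: le_trans (ler_wpM2r (l2norm_ge0 _) _) _; last first.
      by apply: ler_wpM2l Ke; apply: ltW.
    by have := ler_norm M; lra.
  by rewrite mulrC divfK// gt_eqF.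
move: K finK {Ke}; apply: finite_set_ind => [|A x _ Ax IH].
  by rewrite chi_set0 -(scale0r 0) phiZ mul0r.
by rewrite chi_setU1// phiD IH phiZ phid mulr0 addr0.
Qed.

Lemma finite_supp_ell2 K (f : X -> R[i]) : finite_set K ->
  exists w, forall x, w x = if x \in K then f x else 0.
Proof.
move: K; apply: finite_set_ind => [|A x _ Ax [w wE]].
  by exists 0 => x; rewrite in_set0.
exists (w + f x *: delta R x) => y.
rewrite ell2D ell2Z deltaE wE in_setU in_set1.
have [->|yx] := eqVneq y x; last by rewrite /= mulr0 addr0.
by rewrite (memNset Ax) mulr1 add0r.
Qed.

Lemma sqsummable_fsets (f : X -> R[i]^o) (M : R) :
  (forall w K, finite_set K -> (forall x, w x = if x \in K then f x else 0) ->
     l2norm w <= M) ->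
  (sqnorm f <= (M ^+ 2)%:E)%E.
Proof.
move=> wM; apply: ge_ereal_sup => _ [K [finK _] <-].
have [w wE] := finite_supp_ell2 f finK.
have -> : (\sum_(x \in K) (normc (f x) ^+ 2)%:E)%E = (l2norm w ^+ 2)%:E.
  rewrite sqr_l2norm /sqnorm -esum_fset//; last by move=> x _; rewrite lee_fin sqr_ge0.
  rewrite esum_mkcond; apply: eq_esum => x _; rewrite wE.
  by case: ifP; rewrite ?normc0 ?expr0n.
have le := wM w K finK wE; have w0 := l2norm_ge0 w.
by rewrite lee_fin lerXn2r ?nnegrE// (le_trans w0).
Qed.

(** Testing [a] against the vector whose coordinates are those of the adjoint,
    cut down to a finite set, is what bounds the norm of these coordinates. *)
Lemma inner_bop_finite a v w K : finite_set K ->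
  (forall x, w x = if x \in K then (inner (a (delta R x)) v)^*%C else 0) ->
  inner (a w) v = ((l2norm w ^+ 2)%:C)%C.
Proof.
move=> finK; move: K finK w; apply: (finite_set_ind (P := fun K => forall w,
  (forall x, w x = if x \in K then (inner (a (delta R x)) v)^*%C else 0) -> _))
  => [|A x finA Ax IH] w wE.
  have -> : w = 0 by apply: ell2P => x; rewrite wE in_set0.
  by rewrite bop0 inner0l l2norm0 expr0n.
have [w' w'E] := finite_supp_ell2 (fun x => (inner (a (delta R x)) v)^*%C) finA.
have wE' : w = w' + (inner (a (delta R x)) v)^*%C *: delta R x.
  apply: ell2P => y; rewrite wE ell2D ell2Z deltaE w'E in_setU in_set1.
  have [->|yx] := eqVneq y x; last by rewrite /= mulr0 addr0.
  by rewrite (memNset Ax) mulr1 add0r.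
rewrite wE' bopD innerDl (IH _ w'E) bopZ innerZl mulrC mulc_conj.
rewrite sqr_l2norm_disj; last first.
  move=> y; rewrite ell2Z deltaE w'E; have [->|yx] := eqVneq y x; last by right; rewrite mulr0.
  by left; rewrite (memNset Ax).
by rewrite l2normZ normc_conj l2norm_delta mulr1 rmorphD.
Qed.

Section AdjointExists.
Variable a : bop R X.

(** The coordinates of the adjoint of [a] at [v], forced by testing on the
    basis vectors. *)
Definition adj_coord v : X -> R[i]^o := fun x => (inner (a (delta R x)) v)^*%C.

Lemma sqnorm_adj_coord v : (sqnorm (adj_coord v) <= ((opnorm a * l2norm v) ^+ 2)%:E)%E.
Proof.
apply: sqsummable_fsets => w K finK wE.
have := inner_bop_finite finK wE => /(congr1 (@normc R)).
rewrite normc_real ger0_norm ?sqr_ge0// => nE.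
have := CauchySchwarz (a w) v; rewrite nE => le.
have [w0|w0] := eqVneq (l2norm w) 0.
  by rewrite w0 mulr_ge0 ?opnorm_ge0 ?l2norm_ge0.
rewrite -(@ler_pM2l _ (l2norm w)); last by rewrite lt_neqAle eq_sym w0 l2norm_ge0.
rewrite -expr2 (le_trans le)// mulrA ler_wpM2r ?l2norm_ge0//.
by rewrite mulrC l2norm_bop_le.
Qed.

Lemma adj_coord_sqsummable v : adj_coord v \in @sqsummable R X.
Proof. by apply/asboolP; apply: le_lt_trans (sqnorm_adj_coord v) _; rewrite ltry. Qed.

Lemma adj_bounded : (fun v => Ell2 (adj_coord_sqsummable v)) \in @bounded_op R X.
Proof.
apply/asboolP; split.
  move=> z u v; apply: ell2P => x; rewrite ell2D ell2Z /= /adj_coord.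
  by rewrite innerDr innerZr conjcD conjcM conjcK.
exists (opnorm a) => v; apply: l2norm_le; first by rewrite mulr_ge0 ?opnorm_ge0 ?l2norm_ge0.
exact: sqnorm_adj_coord.
Qed.

Lemma adj_spec u v : inner (a u) v = inner u (Bop adj_bounded v).
Proof.
apply/eqP; rewrite -subr_eq0; apply/eqP; move: u.
apply: (@bounded_functional_eq0 _ (opnorm a * l2norm v + l2norm (Bop adj_bounded v))).
- by move=> u u'; rewrite bopD !innerDl opprD addrACA.
- by move=> z u; rewrite bopZ !innerZl mulrBr.
- move=> u; apply: le_trans (le_normcD _ _) _; rewrite normc_opp mulrDl lerD//.
    apply: le_trans (CauchySchwarz _ _) _; rewrite mulrAC ler_wpM2r ?l2norm_ge0//.
    exact: l2norm_bop_le.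
  by apply: le_trans (CauchySchwarz _ _) _; rewrite mulrC.
- by move=> x; rewrite (innerC _ (delta R x)) inner_delta conjcK subrr.
Qed.

End AdjointExists.

Lemma inner_ext v w : (forall u, inner u v = inner u w) -> v = w.
Proof.
by move=> h; apply: ell2P => x; rewrite -!inner_delta !(innerC (delta R x)) h.
Qed.

Lemma adjointP a u v : inner (a u) v = inner u (adjoint a v).
Proof.
rewrite /adjoint; case: xgetP => [b _ ab//|/(_ (Bop (adj_bounded a)))].
by case; exact: adj_spec.
Qed.

Lemma adjoint_unique a b : (forall u v, inner (a u) v = inner u (b v)) -> adjoint a = b.
Proof. by move=> ab; apply: bopP => v; apply: inner_ext => u; rewrite -adjointP. Qed.

End Operators.

(** * The Schur test and operators of finite propagation *)

Section SchurTest.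
Context {R : realType}.

Lemma esum_exchange (T1 T2 : choiceType) (a : T1 -> T2 -> \bar R) :
  (forall i j, 0 <= a i j)%E ->
  (\esum_(i in [set: T1]) \esum_(j in [set: T2]) a i j =
   \esum_(j in [set: T2]) \esum_(i in [set: T1]) a i j)%E.
Proof.
move=> a0; rewrite !esum_esum//.
rewrite (reindex_esum ([set: T2] `*`` fun=> [set: T1]) _ (fun p => (p.2, p.1)))//.
split=> // [[i j] [i' j'] _ _ /= [-> ->]//|[i j] _].
by exists (j, i).
Qed.

Lemma esum_cst_le (T : choiceType) (B : set T) (n : nat) (c : R) : 0 <= c ->
  (B #<= `I_n)%card -> (\esum_(x in B) c%:E <= (n%:R * c)%:E)%E.
Proof.
move=> c0 Bn; have finB : finite_set B by apply/finite_set_leP; exists n.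
rewrite esum_fset//.
rewrite fsbig_finite//= sumEFin lee_fin big_const_seq count_predT iter_addr_0.
by rewrite -[leLHS]mulr_natl ler_wpM2r// ler_nat (geq_card_fset_set Bn).
Qed.

Lemma sqr_l2norm_chi (X : choiceType) (A : set X) (u : ell2 R X) :
  (l2norm (chi R A u) ^+ 2)%:E = (\esum_(x in A) (normc (u x) ^+ 2)%:E)%E.
Proof.
rewrite sqr_l2norm /sqnorm [RHS]esum_mkcond; apply: eq_esum => x _.
by rewrite chiE; case: ifP; rewrite // normc0 expr0n.
Qed.

Lemma inner_chi (X : choiceType) (A : set X) (u v : ell2 R X) :
  inner (chi R A u) v = inner u (chi R A v).
Proof.
have eq x : chi R A u x * (v x)^*%C = u x * (chi R A v x)^*%C.
  by rewrite !chiE; case: ifP; rewrite // mul0r conjc0 mulr0.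
apply: complex_eq; rewrite ?Re_inner ?Im_inner; congr rsum; apply/funext => x;
  by rewrite eq.
Qed.

Lemma l2norm_supp_le (X : choiceType) (A : set X) n (M : R) (w : ell2 R X) :
  0 <= M -> (A #<= `I_n)%card -> (forall x, ~ A x -> w x = 0) ->
  (forall x, normc (w x) <= M) -> l2norm w ^+ 2 <= n%:R * M ^+ 2.
Proof.
move=> M0 An wA wM; rewrite -lee_fin.
have -> : w = chi R A w.
  by apply: ell2P => x; rewrite chiE; case: ifPn => // /negP xA; apply: wA => Ax; apply/xA/mem_set.
rewrite sqr_l2norm_chi; apply: le_trans (esum_cst_le (sqr_ge0 M) An).
by apply: le_esum => x _; rewrite lee_fin lerXn2r ?nnegrE ?normc_ge0.
Qed.

Variable X : metricType R.
Implicit Types (u v w : ell2 R X) (a b c : bop R X).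

Lemma mem_ball (x y : X) (r : R) : (y \in (ball x r : set X)) = (mdist x y < r).
Proof. by rewrite ballEmdist; apply/idP/idP; rewrite inE. Qed.

(** Summing the hypothesis over [y] counts each coordinate of [u] once for every
    ball of radius [r] that contains it, hence at most [n] times. *)
Lemma schur_test (r : R) n (f : X -> R[i]^o) (M : R) u : 0 <= M ->
  (forall x : X, (ball x r #<= `I_n)%card) ->
  (forall y, normc (f y) ^+ 2 <= M * l2norm (chi R (ball y r) u) ^+ 2) ->
  (sqnorm f <= (M * (n%:R * l2norm u ^+ 2))%:E)%E.
Proof.
move=> M0 ballX fM.
apply: (@le_trans _ _ (\esum_(y in [set: X]) (M%:E * (l2norm (chi R (ball y r) u) ^+ 2)%:E))%E).
  by apply: le_esum => y _; rewrite -EFinM lee_fin.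
apply: le_trans (esumZl_le _ _) _ => //; first by move=> y; rewrite lee_fin sqr_ge0.
rewrite EFinM lee_wpmul2l//.
under eq_esum do rewrite sqr_l2norm_chi esum_mkcond.
rewrite esum_exchange; last by move=> y x; case: ifP => // _; rewrite lee_fin sqr_ge0.
rewrite EFinM sqr_l2norm /sqnorm.
apply: le_trans (esumZl_le _ _); rewrite ?ler0n//; last first.
  by move=> x; rewrite lee_fin sqr_ge0.
apply: le_esum => x _; rewrite -EFinM.
under eq_esum do rewrite mem_ball metric_sym -mem_ball.
rewrite -(esum_mkcond (ball x r) (fun=> (normc (u x) ^+ 2)%:E)).
exact: esum_cst_le (sqr_ge0 _) (ballX x).
Qed.

Lemma adjoint_entry a (x y : X) :
  adjoint a (delta R y) x = (a (delta R x) y)^*%C.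
Proof.
by rewrite -inner_delta (innerC (delta R x)) -adjointP inner_delta.
Qed.

(** The row of [c] at [y] is the adjoint applied to a basis vector, so it is
    supported in a ball around [y]; its norm is controlled by the number of
    points of that ball, and the Schur test sums over [y]. *)
Lemma band_bound (s r : R) n c (M : R) : s < r -> 0 <= M ->
  (forall x : X, (ball x r #<= `I_n)%card) ->
  (forall x y, c (delta R x) y != 0 -> mdist x y <= s) ->
  (forall x y, normc (c (delta R x) y) <= M) ->
  forall u, l2norm (c u) <= n%:R * M * l2norm u.
Proof.
move=> sr M0 ballX cs cM u.
apply: l2norm_le; first by rewrite !mulr_ge0 ?ler0n ?l2norm_ge0.
have -> : (n%:R * M * l2norm u) ^+ 2 = n%:R * M ^+ 2 * (n%:R * l2norm u ^+ 2) by ring.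
apply: (schur_test (r := r)) => //; first by rewrite mulr_ge0 ?ler0n ?sqr_ge0.
move=> y; set v := adjoint c (delta R y).
have v0 x : ~ ball y r x -> v x = 0.
  move=> yx; rewrite /v adjoint_entry; have [->|] := eqVneq (c (delta R x) y) 0.
    by rewrite conjc0.
  move/cs => xy; exfalso; apply: yx; rewrite ballEmdist/= metric_sym.
  exact: le_lt_trans xy sr.
have -> : c u y = inner (chi R (ball y r) u) v.
  rewrite -inner_delta adjointP inner_chi; congr (inner u _).
  apply: ell2P => x; rewrite chiE; case: ifPn => // /negP xy.
  by apply: v0 => yx; apply/xy/mem_set.
have vM : l2norm v ^+ 2 <= n%:R * M ^+ 2.
  apply: (@l2norm_supp_le _ (ball y r)) => // x.
  by rewrite /v adjoint_entry normc_conj.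
have := sqr_CauchySchwarz (chi R (ball y r) u) v.
move=> /le_trans; apply.
by rewrite mulrC ler_wpM2r ?sqr_ge0.
Qed.

(** This single operator of finite propagation joins all pairs of points at
    distance less than [r]; it stands in for the partial translations. *)
Lemma adjacency_exists (r : R) : unif_locally_finite X ->
  exists D : bop R X, forall x y, D (delta R x) y = (mdist x y < r)%R%:R.
Proof.
move=> /(_ r)[n ballX].
have fin y : finite_set (ball y r : set X).
  by apply/finite_set_leP; exists n; exact: ballX.
pose q (y : X) : ell2 R X := sval (cid (finite_supp_ell2 (fun=> 1) (fin y))).
have qE y x : q y x = (mdist y x < r)%R%:R.
  by rewrite /q; case: cid => /= w ->; rewrite mem_ball; case: ifP.
have qn y : l2norm (q y) ^+ 2 <= n%:R.
  have -> : n%:R = n%:R * 1 ^+ 2 :> R by rewrite expr1n mulr1.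
  apply: (@l2norm_supp_le _ (ball y r)) => // x.
    by rewrite ballEmdist/= => /negP xy; rewrite qE (negPf xy).
  by rewrite qE; case: (_ < _); rewrite ?normc1 ?normc0.
have Dbound u : (sqnorm (fun y => inner u (q y) : R[i]^o) <= (n%:R * (n%:R * l2norm u ^+ 2))%:E)%E.
  apply: (schur_test (r := r)); rewrite ?ler0n// => y.
  have -> : q y = chi R (ball y r) (q y).
    by apply: ell2P => x; rewrite chiE mem_ball qE; case: (_ < _).
  rewrite -inner_chi; have := sqr_CauchySchwarz (chi R (ball y r) u) (q y).
  move=> /le_trans; apply.
  by rewrite mulrC ler_wpM2r ?sqr_ge0.
have Dsum u : (fun y => inner u (q y) : R[i]^o) \in @sqsummable R X.
  by apply/asboolP; apply: le_lt_trans (Dbound u) _; rewrite ltry.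
have Dop : (fun u => Ell2 (Dsum u)) \in @bounded_op R X.
  apply/asboolP; split.
    by move=> z u v; apply: ell2P => x; rewrite ell2D ell2Z /= innerDl innerZl.
  exists n%:R => u; apply: l2norm_le; first by rewrite mulr_ge0 ?ler0n ?l2norm_ge0.
  by apply: le_trans (Dbound u) _; rewrite lee_fin; lra.
exists (Bop Dop) => x y /=; rewrite innerC inner_delta qE metric_sym.
by case: (_ < _); [exact: conjc1|exact: conjc0].
Qed.

End SchurTest.

Section RoeElements.
Context {R : realType} (X : metricType R).
Implicit Types (u v w xi : ell2 R X) (a b c : bop R X).

Lemma finite_propagationP a : (propagation a < +oo)%E <->
  exists2 s : R, 0 <= s & forall x y, a (delta R x) y != 0 -> mdist x y <= s.
Proof.
split=> [afin|[s s0 as_]].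
  have a0 : (0 <= propagation a)%E by apply: ereal_sup_ubound; left.
  exists (fine (propagation a)); first exact: fine_ge0.
  move=> x y axy; rewrite -lee_fin fineK; last by rewrite ge0_fin_numE.
  by apply: ereal_sup_ubound; right; exists (x, y) => //=; rewrite inner_delta.
apply: (@le_lt_trans _ _ s%:E); last exact: ltry.
apply: ge_ereal_sup => _ [->|[[x y] /= axy <-]]; first by rewrite lee_fin.
by rewrite lee_fin as_// -inner_delta.
Qed.

Lemma finite_propagation_roe a : (propagation a < +oo)%E -> uniform_roe X a.
Proof.
move=> afin e e0; exists a => //; apply: opnorm_le; first exact: ltW.
by move=> u; rewrite subrr bop0E l2norm0 mulr_ge0 ?l2norm_ge0 ?ltW.
Qed.

Lemma chi_roe (A : set X) : uniform_roe X (chi R A).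
Proof.
apply/finite_propagation_roe/finite_propagationP; exists 0 => // x y.
rewrite chi_delta; case: ifP => _; last by rewrite eqxx.
by rewrite deltaE; have [->|] := eqVneq y x; rewrite ?mdistxx ?eqxx.
Qed.

Section RankOne.
Variables w xi : ell2 R X.

Lemma rank_one_bounded : (fun v => inner v xi *: w) \in @bounded_op R X.
Proof.
apply/asboolP; split.
  by move=> z u v; rewrite /= innerDl innerZl scalerDl scalerA.
exists (l2norm xi * l2norm w) => u; rewrite l2normZ mulrAC.
by rewrite ler_wpM2r ?l2norm_ge0// mulrC CauchySchwarz.
Qed.

Definition rank_one : bop R X := Bop rank_one_bounded.

Lemma rank_oneE v : rank_one v = inner v xi *: w. Proof. by []. Qed.
End RankOne.

Lemma adjoint_rank_one w xi : adjoint (rank_one w xi) = rank_one xi w.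
Proof.
by apply: adjoint_unique => u v; rewrite !rank_oneE innerZl innerZr mulrC -innerC.
Qed.

Lemma bop_rank_one a w xi : a * rank_one w xi = rank_one (a w) xi.
Proof. by apply: bopP => u; rewrite bopME !rank_oneE bopZ. Qed.

Lemma rank_oneM w xi w' xi' :
  rank_one w xi * rank_one w' xi' = inner w' xi *: rank_one w xi'.
Proof.
by apply: bopP => u; rewrite bopME bopZE !rank_oneE innerZl !scalerA mulrC.
Qed.

Lemma finite_set_bounded (T : choiceType) (A : set T) (f : T -> R) :
  finite_set A -> exists2 s : R, 0 <= s & forall x, A x -> f x <= s.
Proof.
move: A; apply: finite_set_ind => [|A x _ Ax [s s0 As]]; first by exists 0.
exists (Num.max s (f x)); first by rewrite le_max s0.
by move=> y [->|/As ys]; rewrite le_max ?lexx ?orbT// ys.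
Qed.

(** Cutting both vectors down to finite sets of coordinates leaves finitely many
    nonzero matrix entries and changes the operator little in norm. *)
Lemma rank_one_roe w xi : uniform_roe X (rank_one w xi).
Proof.
move=> e e0.
have [nw nx] : 0 < l2norm w + 1 /\ 0 < l2norm xi + 1.
  by have := l2norm_ge0 w; have := l2norm_ge0 xi; lra.
have e20 : 0 < e / 2 by lra.
have [K finK wK] := chi_tail w (divr_gt0 e20 nx).
have [L finL xL] := chi_tail xi (divr_gt0 e20 nw).
exists (rank_one (chi R K w) (chi R L xi)).
  apply/finite_propagationP.
  have [s s0 sP] := finite_set_bounded (fun p : X * X => mdist p.1 p.2) (finite_setX finL finK).
  exists s => // x y; rewrite rank_oneE ell2Z innerC inner_delta !chiE => ne0.
  apply: (sP (x, y)); split => /=; apply: contrapT => xN; move: ne0;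
    by rewrite (memNset xN) ?conjc0 ?mulr0 ?mul0r eqxx.
apply: opnorm_le => [|u]; first exact: ltW.
have -> : (rank_one w xi - rank_one (chi R K w) (chi R L xi)) u =
    inner u xi *: chi R (~` K) w + inner u (chi R (~` L) xi) *: chi R K w.
  have split2 (p q : R[i]) (s t : ell2 R X) :
      (p + q) *: (s + t) - p *: s = (p + q) *: t + q *: s.
    by rewrite scalerDr addrAC [(p + q) *: s]scalerDl [p *: s + _]addrC addrK addrC.
  rewrite bopBE !rank_oneE -{1}(chiD_compl K w) -{1 3}(chiD_compl L xi).
  by rewrite innerDr split2.
apply: le_trans (ler_l2normD _ _) _; rewrite !l2normZ.
have b1 : normc (inner u xi) * l2norm (chi R (~` K) w) <= e / 2 * l2norm u.
  apply: (@le_trans _ _ ((l2norm u * (l2norm xi + 1)) * (e / 2 / (l2norm xi + 1)))).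
    rewrite ler_pM ?normc_ge0 ?l2norm_ge0//; apply: le_trans (CauchySchwarz _ _) _.
    by rewrite ler_wpM2l ?l2norm_ge0// lerDl.
  by rewrite -mulrA [X in _ * X]mulrC divfK ?gt_eqF// mulrC.
have b2 : normc (inner u (chi R (~` L) xi)) * l2norm (chi R K w) <= e / 2 * l2norm u.
  apply: (@le_trans _ _ ((l2norm u * (e / 2 / (l2norm w + 1))) * (l2norm w + 1))).
    rewrite ler_pM ?normc_ge0 ?l2norm_ge0//.
      by apply: le_trans (CauchySchwarz _ _) _; rewrite ler_wpM2l ?l2norm_ge0.
    by apply: le_trans (l2norm_chi_le _ _) _; rewrite lerDl.
  by rewrite -mulrA divfK ?gt_eqF// mulrC.
by apply: le_trans (lerD b1 b2) _; rewrite -mulrDl -splitr.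
Qed.

End RoeElements.

(** * Slowly varying multipliers *)

Section LipschitzMultipliers.
Context {R : realType} (X : metricType R).
Implicit Types (u v : ell2 R X) (a b m : bop R X).

(** Multiplication by a [d]-Lipschitz function with values in the unit interval;
    the function is quantified away because only the operator is used. *)
Definition lip_mult (d : R) m := exists f : X -> R,
  [/\ forall x, 0 <= f x <= 1, forall x y, `|f x - f y| <= d * mdist x y
    & forall u x, m u x = (f x)%:C%C * u x].

Lemma lip_mult_mono d d' m : d <= d' -> lip_mult d m -> lip_mult d' m.
Proof.
move=> dd' [f [f01 fd mE]]; exists f; split=> // x y.
by apply: le_trans (fd x y) _; rewrite ler_wpM2r// mdist_ge0.
Qed.

Lemma lip_mult_le d m u : lip_mult d m -> l2norm (m u) <= l2norm u.
Proof.
move=> [f [f01 _ mE]]; apply: l2norm_le; rewrite ?l2norm_ge0// sqr_l2norm.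
apply: le_esum => x _; rewrite mE normcM normc_real lee_fin exprMn.
have /andP[f0 f1] := f01 x; rewrite ger0_norm// -[leRHS]mul1r.
by rewrite ler_wpM2r ?sqr_ge0// expr_le1.
Qed.

Lemma mult_exists (f : X -> R) : (forall x, 0 <= f x <= 1) ->
  exists m : bop R X, forall u x, m u x = (f x)%:C%C * u x.
Proof.
move=> f01.
have le u : (sqnorm (fun x => (f x)%:C%C * u x : R[i]^o)%R <= sqnorm u)%E.
  apply: le_esum => x _; rewrite normcM normc_real lee_fin exprMn.
  have /andP[f0 f1] := f01 x; rewrite ger0_norm// -[leRHS]mul1r.
  by rewrite ler_wpM2r ?sqr_ge0// expr_le1.
have sq u : (fun x => (f x)%:C%C * u x : R[i]^o) \in @sqsummable R X.
  by apply/asboolP; apply: le_lt_trans (le u) _; exact/asboolP/ell2_funP.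
have bd : (fun u => Ell2 (sq u)) \in @bounded_op R X.
  apply/asboolP; split.
    move=> z u v; apply: ell2P => x; rewrite ell2D ell2Z /=.
    transitivity ((f x)%:C%C * (z * u x + v x)); first by [].
    by rewrite mulrDr !mulrA [_ * z]mulrC.
  exists 1 => u; rewrite mul1r; apply: l2norm_le; rewrite ?l2norm_ge0//.
  by rewrite sqr_l2norm; exact: le.
by exists (Bop bd).
Qed.

(** The function is [1] minus [d] times the distance to [A], truncated at [0].
    Writing it as a supremum that includes [0] covers the case of an empty [A]. *)
Lemma lip_mult_separates (d : R) (A B : set X) : 0 < d ->
  ((d^-1)%:E < setdist A B)%E -> exists m, [/\ lip_mult d m,
    forall u, m (chi R A u) = chi R A u & forall u, m (chi R B u) = 0].
Proof.
move=> d0 dAB.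
pose F y := [set 0] `|` [set 1 - d * mdist y x | x in A].
pose f y := sup (F y).
have F0 y : F y 0 by left.
have Fub y : ubound (F y) 1.
  move=> _ [->|[x Ax <-]]; first exact: ler01.
  by rewrite lerBlDr lerDl mulr_ge0 ?mdist_ge0// ltW.
have Fhs y : has_sup (F y) by split; [exists 0|exists 1].
have f01 y : 0 <= f y <= 1.
  apply/andP; split; first by apply: ub_le_sup => //; exact: (Fhs y).2.
  by apply: ge_sup => //; exists 0.
have flip y z : f y - f z <= d * mdist y z.
  rewrite lerBlDr; apply: ge_sup; first by exists 0.
  move=> _ [->|[x Ax <-]].
    by rewrite addr_ge0 ?mulr_ge0 ?mdist_ge0 ?(ltW d0)//; have /andP[] := f01 z.
  apply: (@le_trans _ _ (d * mdist y z + (1 - d * mdist z x))).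
    have : d * mdist z x <= d * (mdist y z + mdist y x).
      apply: ler_wpM2l; first exact: ltW.
      by rewrite [mdist y z]metric_sym; exact: metric_triangle.
    by lra.
  by rewrite lerD2l; apply: ub_le_sup; [exact: (Fhs z).2|right; exists x].
have [m mE] := mult_exists f01.
exists m; split.
- exists f; split=> // x y; rewrite ler_norml flip andbT.
  by have := flip y x; rewrite metric_sym; lra.
- move=> u; apply: ell2P => x; rewrite mE chiE; case: ifPn => [|_]; last by rewrite mulr0.
  rewrite inE => Ax; suff -> : f x = 1 by rewrite mul1r.
  apply/eqP; rewrite eq_le; have /andP[_ ->] := f01 x.
  apply: ub_le_sup; first exact: (Fhs x).2.
  by right; exists x => //; rewrite mdistxx mulr0 subr0.
- move=> u; apply: ell2P => x; rewrite mE chiE; case: ifPn => [|_]; last by rewrite mulr0.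
  rewrite inE => Bx; suff -> : f x = 0 by rewrite mul0r.
  apply/eqP; rewrite eq_le; have /andP[-> _] := f01 x; rewrite andbT.
  apply: ge_sup; first by exists 0.
  move=> _ [->//|[y Ay <-]].
  have : ((d^-1)%:E <= (mdist y x)%:E)%E.
    by apply: le_trans (ltW dAB) _; apply: ereal_inf_lbound; exists (y, x).
  rewrite lee_fin => le; rewrite metric_sym subr_le0.
  by rewrite -(@divff _ d) ?gt_eqF// ler_wpM2l// ltW.
Qed.

(** For an operator of propagation at most [s], the commutator has entries bounded
    by [d * s] times its norm, so the Schur test applies; such operators are dense
    in the uniform Roe algebra. *)
Lemma roe_commutes_lip b (e : R) : unif_locally_finite X -> uniform_roe X b ->
  0 < e -> exists2 d : R, 0 < d & forall m, lip_mult d m ->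
    forall u, l2norm (m (b u) - b (m u)) <= e * l2norm u.
Proof.
move=> ulf bR e0; have e4 : 0 < e / 4 by lra.
have [b0 /finite_propagationP[s s0 b0s] bb0] := bR _ e4.
have [n ballX] := ulf (s + 1).
set beta := opnorm b0; have beta0 : 0 <= beta := opnorm_ge0 b0.
pose N := n%:R * (s * beta) + 1.
have N0 : 0 < N by rewrite ltr_pwDr// mulr_ge0 ?ler0n ?mulr_ge0.
exists (e / 2 / N); first by rewrite divr_gt0//; lra.
move=> m mlip u; have [f [f01 flip mE]] := mlip.
set d := e / 2 / N in flip mlip; have d0 : 0 <= d by rewrite divr_ge0// ltW//; lra.
have c0 : l2norm (m (b0 u) - b0 (m u)) <= e / 2 * l2norm u.
  have -> : m (b0 u) - b0 (m u) = (m * b0 - b0 * m) u by [].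
  have entry x y : (m * b0 - b0 * m) (delta R x) y =
      ((f y - f x)%:C)%C * b0 (delta R x) y.
    rewrite bopBE ell2B !bopME mE (_ : m (delta R x) = (f x)%:C%C *: delta R x).
      by rewrite bopZ ell2Z rmorphB mulrBl.
    apply: ell2P => z; rewrite mE ell2Z deltaE.
    by have [->//|_] := eqVneq z x; rewrite !mulr0.
  apply: le_trans (band_bound (s := s) (r := s + 1) (M := d * s * beta) _ _ ballX _ _ u) _.
  - by rewrite ltrDl.
  - by apply: mulr_ge0 => //; apply: mulr_ge0.
  - by move=> x y; rewrite entry => ne0; apply: b0s; apply: contra ne0 => /eqP ->; rewrite mulr0.
  - move=> x y; rewrite entry normcM normc_real.
    have [->|ne0] := eqVneq (b0 (delta R x) y) 0.
      by rewrite normc0 mulr0; apply: mulr_ge0 => //; apply: mulr_ge0.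
    rewrite ler_pM ?normc_ge0//; last first.
      by have := normc_entry_le b0 (delta R x) y; rewrite l2norm_delta mulr1.
    apply: le_trans (flip y x) _; rewrite ler_wpM2l// metric_sym; exact: b0s.
  - rewrite ler_wpM2r ?l2norm_ge0//.
    have -> : n%:R * (d * s * beta) = d * (N - 1) by rewrite /N; ring.
    have -> : e / 2 = d * N by rewrite /d divfK// gt_eqF.
    by rewrite ler_wpM2l//; lra.
have diff v : l2norm (b v - b0 v) <= e / 4 * l2norm v.
  by move/(opnorm_leP (b - b0) (ltW e4)): bb0; exact.
have -> : m (b u) - b (m u) =
    (m (b u - b0 u) - (b (m u) - b0 (m u))) + (m (b0 u) - b0 (m u)).
  by rewrite bopB opprB addrAC !subrKA.
apply: le_trans (ler_l2normD _ _) _.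
have t1 := ler_l2normB (m (b u - b0 u)) (b (m u) - b0 (m u)).
have t2 := le_trans (lip_mult_le (b u - b0 u) mlip) (diff u).
have t3 := le_trans (diff (m u)) (ler_wpM2l (ltW e4) (lip_mult_le u mlip)).
apply: le_trans (lerD (le_trans t1 (lerD t2 t3)) c0) _; rewrite -!mulrDl.
by rewrite (_ : _ + _ = e)//; field.
Qed.

End LipschitzMultipliers.

(** * Unitaries and conjugation *)

(** The inverse is carried as data so that conjugation by a unitary is an
    explicit composite of maps. *)
Record unitary (R : realType) (X Y : choiceType) := Unitary {
  ufun :> ell2 R X -> ell2 R Y ;
  uinv : ell2 R Y -> ell2 R X ;
  ufunD : forall u v, ufun (u + v) = ufun u + ufun v ;
  ufunZ : forall (z : R[i]) u, ufun (z *: u) = z *: ufun u ;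
  inner_ufun : forall u v, inner (ufun u) (ufun v) = inner u v ;
  ufunK : cancel ufun uinv ;
  uinvK : cancel uinv ufun }.

Section Unitary.
Context {R : realType} {X Y : choiceType}.
Variable U : unitary R X Y.
Local Notation V := (uinv U).

Lemma uinvD u v : V (u + v) = V u + V v.
Proof. by apply: (can_inj (ufunK U)); rewrite ufunD !uinvK. Qed.

Lemma uinvZ (z : R[i]) u : V (z *: u) = z *: V u.
Proof. by apply: (can_inj (ufunK U)); rewrite ufunZ !uinvK. Qed.

Lemma inner_uinv u v : inner (V u) (V v) = inner u v.
Proof. by rewrite -(inner_ufun U) !uinvK. Qed.

Definition unitary_inv : unitary R Y X :=
  Unitary uinvD uinvZ inner_uinv (uinvK U) (ufunK U).

Lemma l2norm_ufun u : l2norm (U u) = l2norm u.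
Proof.
have /(congr1 (@complex.Re R)) := inner_ufun U u u; rewrite !innerxx /=.
by move=> /eqP; rewrite eqrXn2 ?l2norm_ge0// => /eqP.
Qed.

Lemma ufunB u v : U (u - v) = U u - U v.
Proof. by rewrite ufunD -scaleN1r ufunZ scaleN1r. Qed.

Lemma conj_op_bounded (a : bop R X) : U \o a \o V \in @bounded_op R Y.
Proof.
apply/asboolP; split.
  by move=> z u v; rewrite /= uinvD uinvZ bopD bopZ ufunD ufunZ.
exists (opnorm a) => u; rewrite /= l2norm_ufun.
apply: le_trans (l2norm_bop_le _ _) _.
by rewrite -[l2norm (V u)]l2norm_ufun uinvK.
Qed.

Definition conj_op (a : bop R X) : bop R Y := Bop (conj_op_bounded a).

Lemma conj_opE a u : conj_op a u = U (a (V u)). Proof. by []. Qed.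

Lemma conj_opD a b : conj_op (a + b) = conj_op a + conj_op b.
Proof. by apply: bopP => u; rewrite bopDE !conj_opE bopDE ufunD. Qed.

Lemma conj_opZ (z : R[i]) a : conj_op (z *: a) = z *: conj_op a.
Proof. by apply: bopP => u; rewrite bopZE !conj_opE bopZE ufunZ. Qed.

Lemma conj_opM a b : conj_op (a * b) = conj_op a * conj_op b.
Proof. by apply: bopP => u; rewrite bopME !conj_opE bopME ufunK. Qed.

Lemma conj_op_adjoint a : conj_op (adjoint a) = adjoint (conj_op a).
Proof.
apply/esym/adjoint_unique => u v; rewrite !conj_opE.
by rewrite -[v in LHS](uinvK U) inner_ufun adjointP -(inner_ufun U) uinvK.
Qed.

End Unitary.

Lemma l2norm_uinv (R : realType) (X Y : choiceType) (U : unitary R X Y) v :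
  l2norm (uinv U v) = l2norm v.
Proof. exact: (l2norm_ufun (unitary_inv U)). Qed.

Lemma uinvB (R : realType) (X Y : choiceType) (U : unitary R X Y) u v :
  uinv U (u - v) = uinv U u - uinv U v.
Proof. exact: (ufunB (unitary_inv U)). Qed.

Lemma conj_opK (R : realType) (X Y : choiceType) (U : unitary R X Y) a :
  conj_op (unitary_inv U) (conj_op U a) = a.
Proof. by apply: bopP => u; rewrite !conj_opE /= !ufunK. Qed.

(** * Operators that almost commute with coordinate projections *)

Section AlmostDiagonal.
Context {R : realType} {X : choiceType}.
Implicit Types (u v z : ell2 R X) (A E K S : set X).

(** The vector on the left is the image of [v] under the reflection [1 - 2 chi_E],
    which changes the signs of the coordinates in [E]. *)
Lemma l2norm_sign E v : l2norm (v - (chi R E v + chi R E v)) = l2norm v.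
Proof.
have disj u w : (forall x, x \in ~` E -> u x = 0) -> (forall x, x \in E -> w x = 0) ->
    forall x, u x = 0 \/ w x = 0.
  by move=> u0 w0 x; have [xE|xE] := boolP (x \in E); [right; apply: w0|
    left; apply: u0; rewrite in_setC].
have cE x : x \in E -> chi R (~` E) v x = 0 by move=> xE; rewrite chiE in_setC xE.
have cN x : x \in ~` E -> chi R E v x = 0.
  by rewrite in_setC => /negPf xE; rewrite chiE xE.
have -> : v - (chi R E v + chi R E v) = - chi R E v + chi R (~` E) v.
  by rewrite -{1}(chiD_compl E v) opprD addrACA subrr add0r addrC.
apply/eqP; rewrite -(@eqrXn2 _ 2) ?l2norm_ge0//; apply/eqP.
rewrite sqr_l2norm_disj; last by apply: disj => // x /cN; rewrite ell2N => ->; rewrite oppr0.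
rewrite l2normN -sqr_l2norm_disj ?chiD_compl//.
exact: disj.
Qed.

(** Choosing the signs of the coordinates of [u] one after the other, the
    parallelogram law lets all cross terms of [l2norm (h _) ^+ 2] be made
    nonpositive, or all of them nonnegative.  The number [q] is the diagonal
    contribution, the sum of the [l2norm (h (u x *: delta R x)) ^+ 2]. *)
Lemma sign_choice (h : bop R X) K u : finite_set K -> exists q : R,
  [/\ exists2 E, E `<=` K &
        l2norm (h (chi R K u - (chi R E u + chi R E u))) ^+ 2 <= q,
      exists2 E, E `<=` K &
        q <= l2norm (h (chi R K u - (chi R E u + chi R E u))) ^+ 2
    & forall c : R, 0 <= c ->
      ((forall x, K x -> l2norm (h (delta R x)) <= c) ->
         q <= c ^+ 2 * l2norm (chi R K u) ^+ 2) /\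
      ((forall x, K x -> c <= l2norm (h (delta R x))) ->
         c ^+ 2 * l2norm (chi R K u) ^+ 2 <= q)].
Proof.
move: K; apply: finite_set_ind => [|K x finK Kx [q [[E EK le] [F FK ge] qc]]].
  exists 0; split.
  - by exists set0 => //; rewrite !chi_set0 addr0 subr0 bop0 l2norm0 expr0n.
  - by exists set0 => //; rewrite !chi_set0 addr0 subr0 bop0 l2norm0 expr0n.
  - by move=> c c0; rewrite !chi_set0 l2norm0 expr0n mulr0.
pose z := u x *: delta R x.
have plus G : G `<=` K -> chi R (x |` K) u - (chi R G u + chi R G u) =
    chi R K u - (chi R G u + chi R G u) + z.
  by move=> GK; rewrite chi_setU1// addrAC.
have minus G : G `<=` K ->
    chi R (x |` K) u - (chi R (x |` G) u + chi R (x |` G) u) =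
    chi R K u - (chi R G u + chi R G u) - z.
  move=> GK; have Gx : ~ G x by move/GK.
  rewrite !chi_setU1// -/z [X in _ - X]addrACA opprD addrACA.
  by congr (_ + _); rewrite opprD addrA subrr sub0r.
have subU G : G `<=` K -> G `<=` x |` K by move=> GK y /GK; right.
have subUU G : G `<=` K -> x |` G `<=` x |` K.
  by move=> GK y [->|/GK]; [left|right].
have par v := parallelogram (h v) (h z).
exists (q + l2norm (h z) ^+ 2); split.
- set v := _ - _ in le; have [small|big] := leP (l2norm (h (v + z)) ^+ 2)
      (l2norm (h v) ^+ 2 + l2norm (h z) ^+ 2).
    exists E; rewrite ?plus//; first exact: subU.
    by apply: le_trans small _; rewrite lerD2r.
  exists (x |` E); rewrite ?minus//; first exact: subUU.
  have := par v; rewrite -bopD -bopB -/v; move: big le; clear; lra.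
- set v := _ - _ in ge; have [big|small] := leP
      (l2norm (h v) ^+ 2 + l2norm (h z) ^+ 2) (l2norm (h (v + z)) ^+ 2).
    exists F; rewrite ?plus//; first exact: subU.
    by apply: le_trans _ big; rewrite lerD2r.
  exists (x |` F); rewrite ?minus//; first exact: subUU.
  have := par v; rewrite -bopD -bopB -/v; move: small ge; clear; lra.
- move=> c c0; have [qle qge] := qc c c0.
  have -> : l2norm (chi R (x |` K) u) ^+ 2 = l2norm (chi R K u) ^+ 2 + l2norm z ^+ 2.
    rewrite chi_setU1// sqr_l2norm_disj// => y; rewrite ell2Z deltaE chiE.
    by have [->|yx] := eqVneq y x; [left; rewrite (memNset Kx)|right; rewrite mulr0].
  have -> : l2norm (h z) ^+ 2 = normc (u x) ^+ 2 * l2norm (h (delta R x)) ^+ 2.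
    by rewrite bopZ l2normZ exprMn.
  have -> : l2norm z ^+ 2 = normc (u x) ^+ 2.
    by rewrite l2normZ l2norm_delta mulr1.
  rewrite mulrDr [c ^+ 2 * normc _ ^+ 2]mulrC; split=> hc; apply: lerD.
  + by apply: qle => y Ky; apply: hc; right.
  + by rewrite ler_wpM2l ?sqr_ge0// lerXn2r ?nnegrE ?l2norm_ge0//; apply: hc; left.
  + by apply: qge => y Ky; apply: hc; right.
  + by rewrite ler_wpM2l ?sqr_ge0// lerXn2r ?nnegrE ?l2norm_ge0//; apply: hc; left.
Qed.

Lemma l2norm_chi_sup A u (M : R) :
  (forall K, finite_set K -> K `<=` A -> l2norm (chi R K u) <= M) ->
  l2norm (chi R A u) <= M.
Proof.
move=> KM; apply/ler_addgt0Pl => e e0; rewrite addrC.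
have [K finK Ke] := chi_tail (chi R A u) e0.
rewrite -(chiD_compl K (chi R A u)); apply: le_trans (ler_l2normD _ _) _.
apply: lerD => //; rewrite chi_chi; apply: KM; last by move=> x [].
exact: sub_finite_set finK.
Qed.

Variables (h : bop R X) (e : R).
Hypothesis h_chi : forall S u, l2norm (h (chi R S u) - chi R S (h u)) <= e * l2norm u.

Lemma l2norm_almost_sign E v :
  `|l2norm (h (v - (chi R E v + chi R E v))) - l2norm (h v)| <= 2 * e * l2norm v.
Proof.
set w := chi R E (h v); set w' := h (chi R E v).
have ww' : l2norm (w' - w) <= e * l2norm v by exact: h_chi.
have ww : l2norm (w - w') <= e * l2norm v by rewrite -l2normN opprB.
rewrite -(l2norm_sign E (h v)) -/w bopB bopD -/w'.
have t1 := ler_l2normD (h v - (w + w)) ((w - w') + (w - w')).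
have t2 := ler_l2normD (h v - (w' + w')) ((w' - w) + (w' - w)).
have t3 := ler_l2normD (w - w') (w - w').
have t4 := ler_l2normD (w' - w) (w' - w).
have e1 : h v - (w + w) + ((w - w') + (w - w')) = h v - (w' + w').
  by rewrite [X in _ + X]addrACA -opprD subrKA.
have e2 : h v - (w' + w') + ((w' - w) + (w' - w)) = h v - (w + w).
  by rewrite [X in _ + X]addrACA -opprD subrKA.
rewrite e1 in t1; rewrite e2 in t2; rewrite ler_norml.
move: t1 t2 t3 t4 ww ww'; clear; move: (l2norm (_ + _)) (l2norm (_ + _)).
move=> a b t1 t2 t3 t4 ww ww'; apply/andP; split; lra.
Qed.

(** A change of signs hardly affects the norm, by [l2norm_almost_sign], and
    suitable signs bring it below, or above, the diagonal contribution. *)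
Lemma almost_diagonal K u : finite_set K -> exists2 q : R,
  `|l2norm (h (chi R K u)) - q| <= 2 * e * l2norm (chi R K u) &
  forall c : R, 0 <= c ->
    ((forall x, K x -> l2norm (h (delta R x)) <= c) ->
       q <= c * l2norm (chi R K u)) /\
    ((forall x, K x -> c <= l2norm (h (delta R x))) ->
       c * l2norm (chi R K u) <= q).
Proof.
move=> finK; have [q [[E EK le] [F FK ge] qc]] := sign_choice h u finK.
have EE G : G `<=` K -> chi R G u = chi R G (chi R K u).
  by move=> GK; rewrite chi_chi; congr (chi R _ u);
    apply/seteqP; split=> [x /[dup] /GK|x []].
have q0 : 0 <= q by apply: le_trans le; exact: sqr_ge0.
exists (Num.sqrt q).
  have := l2norm_almost_sign E (chi R K u); rewrite -EE// => nE.
  have := l2norm_almost_sign F (chi R K u); rewrite -EE// => nF.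
  have le' : l2norm (h (chi R K u - (chi R E u + chi R E u))) <= Num.sqrt q.
    by rewrite -[leLHS]ger0_norm ?l2norm_ge0// -sqrtr_sqr ler_sqrt.
  have ge' : Num.sqrt q <= l2norm (h (chi R K u - (chi R F u + chi R F u))).
    by rewrite -[leRHS]ger0_norm ?l2norm_ge0// -sqrtr_sqr ler_sqrt ?sqr_ge0.
  move: nE nF; rewrite !ler_distl => /andP[nE _] /andP[_ nF].
  apply/andP; split; last first.
    by rewrite -lerBlDr (le_trans nE).
  by rewrite lerBlDr (le_trans ge').
move=> c c0; have [qle qge] := qc c c0; split=> hc.
  rewrite -(@ler_pXn2r _ 2)//= ?nnegrE ?sqrtr_ge0 ?mulr_ge0 ?l2norm_ge0//.
  by rewrite sqr_sqrtr// exprMn qle.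
rewrite -(@ler_pXn2r _ 2)//= ?nnegrE ?sqrtr_ge0 ?mulr_ge0 ?l2norm_ge0//.
by rewrite sqr_sqrtr// exprMn qge.
Qed.

Hypothesis e_small : e <= 1 / 16.

Let e_ge0 u : u != 0 -> 0 <= e.
Proof.
move=> u0; have := le_trans (l2norm_ge0 _) (h_chi set0 u).
rewrite pmulr_lge0// lt_neqAle l2norm_ge0 andbT eq_sym.
by apply: contra u0 => /eqP/l2norm_eq0 ->.
Qed.

(** The part of [z] at the coordinates where the diagonal of [h] is at most
    [1 / 2] is nearly fixed by [h], since [h] nearly commutes with the cut-off;
    but [almost_diagonal] makes [h] shrink it by a factor close to [1 / 2]. *)
Lemma fixed_vector_support z : h z = z ->
  l2norm (chi R [set x | l2norm (h (delta R x)) <= 1 / 2] z) <= 8 * e * l2norm z.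
Proof.
move=> hz; have [->|z0] := eqVneq z 0; first by rewrite bop0 !l2norm0 mulr0.
have e0 := e_ge0 z0; apply: l2norm_chi_sup => K finK KA.
have [q qh qc] := almost_diagonal z finK.
have half : 0 <= 1 / 2 :> R by rewrite divr_ge0.
have {qc} [/(_ KA) qle _] := qc _ half.
have := h_chi K z; rewrite hz => hK.
have tri := ler_l2normB (h (chi R K z)) (h (chi R K z) - chi R K z).
rewrite opprB addrCA subrr addr0 in tri.
move: qh; rewrite ler_distl => /andP[_ qh].
have z1 := l2norm_ge0 (chi R K z); have z2 := l2norm_ge0 z.
move: e_small e0 qh qle hK tri z1 z2; clear.
move: (l2norm (h _)) (l2norm (_ - _)) (l2norm (chi _ _ _)) (l2norm z) => a b k n.
by move=> *; nra.
Qed.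

(** Likewise, the part of [z] at the coordinates where the diagonal is at least
    [1 / 4] is nearly annihilated by [h], and also nearly multiplied by [1 / 4]
    or more. *)
Lemma kernel_vector_support z : h z = 0 ->
  l2norm (chi R [set x | 1 / 4 <= l2norm (h (delta R x))] z) <= 8 * e * l2norm z.
Proof.
move=> hz; have [->|z0] := eqVneq z 0; first by rewrite bop0 !l2norm0 mulr0.
have e0 := e_ge0 z0; apply: l2norm_chi_sup => K finK KA.
have [q qh qc] := almost_diagonal z finK.
have quarter : 0 <= 1 / 4 :> R by rewrite divr_ge0.
have {qc} [_ /(_ KA) qge] := qc _ quarter.
have := h_chi K z; rewrite hz bop0 subr0 => hK.
move: qh; rewrite ler_distl => /andP[qh _].
have z1 := l2norm_ge0 (chi R K z); have z2 := l2norm_ge0 z.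
move: e_small e0 qh qge hK z1 z2; clear.
move: (l2norm (h _)) (l2norm (chi _ _ _)) (l2norm z) => a k n.
by move=> *; nra.
Qed.

(** Since [h] almost commutes with [D] and with the projections onto the two
    coordinates, moving along the entry of [D] from [y] to [x] carries
    [h (delta R y)] approximately to [h (delta R x)]. *)
Lemma diagonal_variation (D : bop R X) (eta : R) x y : D (delta R y) x = 1 ->
  (forall u, l2norm (h (D u) - D (h u)) <= eta * l2norm u) ->
  l2norm (h (delta R x)) <= l2norm (h (delta R y)) + (2 * e * opnorm D + eta).
Proof.
move=> Dyx hD.
have chi1 (w : X) u : chi R [set w] u = u w *: delta R w.
  by rewrite -[[set w]]setU0 chi_setU1// chi_set0 add0r.
have step1 := h_chi [set x] (D (delta R y)).
have step2 := hD (delta R y).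
have step3 := h_chi [set y] (delta R y).
rewrite chi1 Dyx scale1r in step1.
rewrite chi1 deltaE eqxx scale1r [chi R [set y] _]chi1 l2norm_delta mulr1 in step3.
rewrite l2norm_delta mulr1 in step2.
have Dy : l2norm (D (delta R y)) <= opnorm D.
  by have := l2norm_bop_le D (delta R y); rewrite l2norm_delta mulr1.
have e0 : 0 <= e by exact: le_trans (l2norm_ge0 _) step3.
set hy := h (delta R y) in step2 step3 *.
have bound : l2norm (chi R [set x] (D (hy y *: delta R y))) <= l2norm hy.
  rewrite chi1 bopZ ell2Z Dyx mulr1 l2normZ l2norm_delta mulr1.
  exact: normc_le_l2norm.
have split4 : h (delta R x) = (h (delta R x) - chi R [set x] (h (D (delta R y)))) +
    chi R [set x] (h (D (delta R y)) - D hy) +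
    chi R [set x] (D (hy - hy y *: delta R y)) + chi R [set x] (D (hy y *: delta R y)).
  by rewrite !bopB !subrKA subrK.
have s1 : l2norm (h (delta R x) - chi R [set x] (h (D (delta R y)))) <= e * opnorm D.
  by apply: le_trans step1 _; rewrite ler_wpM2l.
have s2 := le_trans (l2norm_chi_le [set x] (h (D (delta R y)) - D hy)) step2.
have s3 : l2norm (chi R [set x] (D (hy - hy y *: delta R y))) <= e * opnorm D.
  apply: le_trans (l2norm_chi_le _ _) _; apply: le_trans (l2norm_bop_le _ _) _.
  by rewrite mulrC ler_wpM2r// opnorm_ge0.
rewrite split4; apply: le_trans (ler_l2normD _ _) _; rewrite addrC lerD//.
apply: le_trans (ler_l2normD _ _) _; apply: le_trans (lerD (ler_l2normD _ _) s3) _.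
apply: le_trans (lerD (lerD s1 s2) (lexx _)) _.
by rewrite (_ : _ + _ = 2 * e * opnorm D + eta)//; ring.
Qed.

End AlmostDiagonal.

(** * Uniform almost commutation by a gliding hump *)

Lemma l2norm_mono (R : realType) (X : choiceType) (u v : ell2 R X) :
  (forall x, normc (u x) <= normc (v x)) -> l2norm u <= l2norm v.
Proof.
move=> uv; apply: l2norm_le; rewrite ?l2norm_ge0// sqr_l2norm.
by apply: le_esum => x _; rewrite lee_fin lerXn2r ?nnegrE ?normc_ge0.
Qed.

Section GlidingHump.
Context {R : realType} {X : choiceType} (Y : metricType R).
Variable U : unitary R X Y.
Hypothesis ulfY : unif_locally_finite Y.
Hypothesis chiY : forall S : set X, uniform_roe Y (conj_op U (chi R S)).

Let b (S : set X) : bop R Y := conj_op U (chi R S).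
Let comm (m : bop R Y) S u : ell2 R Y := m (b S u) - b S (m u).

Let min_l (x y : R) : Num.min x y <= x. Proof. by rewrite ge_min lexx. Qed.
Let min_r (x y : R) : Num.min x y <= y. Proof. by rewrite ge_min lexx orbT. Qed.

Let chi_disj (S T : set X) (u : ell2 R X) : S `&` T = set0 ->
  chi R (S `|` T) u = chi R S u + chi R T u.
Proof.
move=> ST; apply: ell2P => x; rewrite ell2D !chiE in_setU.
have [xS|xS] := boolP (x \in S); have [xT|xT] := boolP (x \in T);
  rewrite /= ?addr0 ?add0r//.
by have : (S `&` T) x by [split; exact/set_mem]; rewrite ST.
Qed.

Let comm_disj m S T u : S `&` T = set0 -> comm m (S `|` T) u = comm m S u + comm m T u.
Proof.
move=> ST; rewrite /comm /b !conj_opE !chi_disj// !ufunD bopD opprD.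
by rewrite addrACA.
Qed.

(** There are only finitely many subsets of [K], so no uniformity is at stake;
    the induction adds one point at a time. *)
Let comm_finite K (e : R) : finite_set K -> 0 < e ->
  exists2 d : R, 0 < d & forall m, lip_mult d m -> forall S u, S `<=` K ->
    l2norm (comm m S u) <= e * l2norm u.
Proof.
move=> finK; move: K finK e; apply: finite_set_ind => [|K x finK Kx IH] e e0.
  exists 1 => // m _ S u; rewrite subset0 => ->.
  by rewrite /comm /b !conj_opE !chi_set0 -(subrr 0) !ufunB !subrr bop0 subrr l2norm0
    mulr_ge0 ?l2norm_ge0 ?ltW.
have e2 : 0 < e / 2 by rewrite divr_gt0.
have [d d0 dP] := IH _ e2.
have [d' d'0 d'P] := roe_commutes_lip ulfY (chiY [set x]) e2.
exists (Num.min d d'); first by rewrite lt_min d0.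
move=> m mlip S u SK.
have m1 := lip_mult_mono (_ : Num.min d d' <= d) mlip.
have m2 := lip_mult_mono (_ : Num.min d d' <= d') mlip.
have {}m1 := dP _ (m1 (min_l _ _)); have {}m2 := d'P _ (m2 (min_r _ _)).
have [Sx|Sx] := pselect (S x); last first.
  apply: le_trans (m1 _ _ _) _; last by rewrite ler_wpM2r ?l2norm_ge0//; lra.
  by move=> y Sy; have [yx|//] := SK y Sy; rewrite yx in Sy.
have -> : S = (S `\ x) `|` [set x].
  by apply/seteqP; split=> [y Sy|y [[]//|->//]]; have [->|yx] := pselect (y = x); [right|left].
rewrite comm_disj; last by apply/seteqP; split=> [y [[_ yx] /= ?]|y//].
apply: le_trans (ler_l2normD _ _) _; rewrite [e in leRHS](splitr e) mulrDl; apply: lerD.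
  by apply: m1 => y [Sy yx]; have [|//] := SK y Sy.
exact: m2.
Qed.

(** One step of the construction in [chi_commutes_lip].  A bad set may be changed
    at will inside the finite window [K], by [comm_finite], so it may be made to
    agree there with the prescribed [T]; and a single vector [u] witnesses
    badness, up to a small tail, through finitely many coordinates. *)
Let step_bad (e : R) : 0 < e ->
  (forall d, 0 < d -> exists m S u, lip_mult d m /\ e * l2norm u < l2norm (comm m S u)) ->
  forall d K T, 0 < d -> finite_set K -> T `<=` K ->
  exists K' T', [/\ finite_set K', T' `<=` K', K `<=` K', T' `&` K = T &
    exists2 m, lip_mult d m & forall S, S `&` K' = T' ->
      exists u, e / 4 * l2norm u < l2norm (comm m S u)].
Proof.
move=> e0 bad d K T d0 finK TK.
have e4 : 0 < e / 4 by rewrite divr_gt0.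
have [d1 d10 d1P] := comm_finite finK e4.
have dd1 : 0 < Num.min d d1 by rewrite lt_min d0.
have [m [S [u [mlip big]]]] := bad _ dd1.
have small := d1P m (lip_mult_mono (min_r _ _) mlip).
have u0 : 0 < l2norm u.
  rewrite lt_neqAle l2norm_ge0 andbT eq_sym; apply/eqP => /l2norm_eq0 u0.
  by move: big; rewrite u0 /comm !bop0 subrr l2norm0 mulr0 ltxx.
pose S1 := T `|` (S `\` K).
have big1 : e / 2 * l2norm u < l2norm (comm m S1 u).
  have commS : comm m S u = comm m (S `&` K) u + comm m (S `\` K) u.
    rewrite -comm_disj ?setUIDK//.
    by apply/seteqP; split=> [y [[_ ?] []]|y].
  have commS1 : comm m S1 u = comm m T u + comm m (S `\` K) u.
    by rewrite -comm_disj//; apply/seteqP; split=> [y [/TK ? []]|y].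
  have s1 := small (S `&` K) u (@subIsetr _ _ _).
  have s2 := small T u TK.
  have t1 := ler_l2normD (comm m (S `&` K) u) (comm m (S `\` K) u).
  have t2 := ler_l2normB (comm m T u + comm m (S `\` K) u) (comm m T u).
  rewrite addrAC subrr add0r in t2.
  rewrite -commS in t1; rewrite -commS1 in t2.
  move: big s1 s2 t1 t2; clear.
  move: (l2norm u) (l2norm _) (l2norm _) (l2norm _) (l2norm _) (l2norm _) => *.
  lra.
have eu : 0 < e / 8 * l2norm u by rewrite mulr_gt0// divr_gt0.
have [K1 finK1 K1u] := chi_tail (uinv U u) eu.
have [K2 finK2 K2u] := chi_tail (uinv U (m u)) eu.
exists (K `|` (K1 `|` K2)), (S1 `&` (K `|` (K1 `|` K2))); split.
- by rewrite !finite_setU.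
- by move=> y [].
- by move=> y; left.
- by apply/seteqP; split=> [y [[[//|[_ ?]] _]]//|y Ty]; split; [split; [left|left; exact: TK]|exact: TK].
exists m; first exact: lip_mult_mono (min_l _ _) mlip.
move=> S2 S2E; exists u.
have tail v L : L `<=` K `|` (K1 `|` K2) ->
    l2norm (b S2 v - b S1 v) <= l2norm (chi R (~` L) (uinv U v)).
  move=> LK; rewrite /b !conj_opE -ufunB l2norm_ufun.
  apply: l2norm_mono => x; rewrite ell2B !chiE in_setC.
  have [xL|xL] := boolP (x \in L).
    have -> : (x \in S2) = (x \in S1).
      have : (x \in S2 `&` (K `|` (K1 `|` K2))) = (x \in S1 `&` (K `|` (K1 `|` K2))).
        by rewrite S2E.
      by rewrite !in_setI (mem_set (LK _ (set_mem xL))) !andbT.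
    by rewrite subrr.
  case: (x \in S2) (x \in S1) => [] []; rewrite ?subrr ?subr0 ?sub0r ?normc_opp ?normc0 ?normc_ge0//.
have t1 := tail u K1 (fun y Ky => or_intror (or_introl Ky)).
have t2 := tail (m u) K2 (fun y Ky => or_intror (or_intror Ky)).
have t3 := lip_mult_le (b S2 u - b S1 u) mlip.
have -> : comm m S2 u = comm m S1 u + (m (b S2 u - b S1 u) - (b S2 (m u) - b S1 (m u))).
  by rewrite /comm bopB opprB addrACA [m (b S1 u) + _]addrC subrK addKr.
have {}t1 := le_trans t1 K1u; have {}t2 := le_trans t2 K2u; have {}t3 := le_trans t3 t1.
set D := m (b S2 u - b S1 u) - _.
have tD : l2norm D <= e / 4 * l2norm u.
  apply: le_trans (ler_l2normB _ _) _; apply: le_trans (lerD t3 t2) _.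
  by rewrite -mulrDl (_ : _ + _ = e / 4)//; field.
have := ler_l2normB (comm m S1 u + D) D; rewrite addrK => tri.
move: big1 tri tD; clear; move: (l2norm u) (l2norm _) (l2norm _) (l2norm _) => *; lra.
Qed.

(** The uniformity in [S] comes from a gliding hump.  If it failed, finite sets
    [T n] and windows [K n] could be chosen one after the other so that any set
    agreeing with [T n.+1] on [K n.+1] violates the estimate at scale
    [n.+1%:R^-1]; the union of the [T n] would then contradict
    [roe_commutes_lip]. *)
Lemma chi_commutes_lip (e : R) : 0 < e ->
  exists2 d : R, 0 < d & forall m, lip_mult d m -> forall S u,
    l2norm (m (conj_op U (chi R S) u) - conj_op U (chi R S) (m u)) <= e * l2norm u.
Proof.
move=> e0; apply: contrapT => nope.
have bad d : 0 < d -> exists m S u, lip_mult d m /\ e * l2norm u < l2norm (comm m S u).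
  move=> d0; apply: contrapT => no; apply: nope; exists d => // m mlip S u.
  by rewrite leNgt; apply/negP => lt; apply: no; exists m, S, u.
have dn n : 0 < n.+1%:R^-1 :> R by rewrite invr_gt0.
pose good n (p q : set X * set X) := [/\ finite_set q.1, q.2 `<=` q.1, p.1 `<=` q.1,
  q.2 `&` p.1 = p.2 & exists2 m, lip_mult n.+1%:R^-1 m & forall S, S `&` q.1 = q.2 ->
      exists u, e / 4 * l2norm u < l2norm (comm m S u)].
have /choice[next nextP] : forall np : nat * (set X * set X), exists q,
    finite_set np.2.1 -> np.2.2 `<=` np.2.1 -> good np.1 np.2 q.
  move=> [n [K T]] /=.
  have [[finK TK]|no] := pselect (finite_set K /\ T `<=` K); last first.
    by exists (K, T) => finK TK; case: no.
  by have [K' [T' good']] := step_bad e0 bad (dn n) finK TK; exists (K', T').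
pose g := fix g n := if n is n'.+1 then next (n', g n') else (set0, set0).
have ginv n : finite_set (g n).1 /\ (g n).2 `<=` (g n).1.
  elim: n => [|n [fin sub]]; first by split.
  by have [] := nextP (n, g n) fin sub.
have gS n : good n (g n) (g n.+1) by have [fin sub] := ginv n; exact: nextP.
have gmono n k : (g n).1 `<=` (g (n + k)%N).1.
  elim: k => [|k IH]; first by rewrite addn0.
  by rewrite addnS; have [_ _ sub _ _] := gS (n + k)%N; exact: subset_trans IH sub.
have gcoh n k : (g (n + k)%N).2 `&` (g n).1 = (g n).2.
  elim: k => [|k IH].
    by rewrite addn0; apply/seteqP; split=> [x []//|x gx]; split=> //; exact: (ginv n).2.
  rewrite addnS; have [_ _ _ coh _] := gS (n + k)%N.
  have -> : (g n).1 = (g (n + k)%N).1 `&` (g n).1 by rewrite setIidr.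
  by rewrite setIA coh.
pose S := \bigcup_n (g n).2.
have SE n : S `&` (g n).1 = (g n).2.
  apply/seteqP; split=> [x [[k _ gkx] gnx]|x gx]; last first.
    by split; [exists n|exact: (ginv n).2].
  have [nk|kn] := leqP n k.
    by rewrite -(gcoh n (k - n)%N) subnKC.
  by move: gkx; rewrite -(gcoh k (n - k)%N) subnKC; [case|exact: ltnW].
have e4 : 0 < e / 4 by rewrite divr_gt0.
have [d d0 dP] := roe_commutes_lip ulfY (chiY S) e4.
have [n nd] : exists n, n.+1%:R^-1 <= d :> R.
  exists (Num.truncn d^-1); rewrite -[leRHS]invrK lef_pV2 ?posrE ?invr_gt0//.
  by rewrite ltW// truncnS_gt.
have [_ _ _ _ [m mlip mbad]] := gS n.
have [u] := mbad S (SE n.+1).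
by rewrite ltNge dP//; exact: lip_mult_mono nd mlip.
Qed.

End GlidingHump.

(** * Conjugation and quasi-locality *)

(** Let [A] and [B] be far apart in [Y], and let [m] be a slowly varying
    multiplier that is [1] on [A] and [0] on [B].  Its conjugate [h] on [X] almost
    commutes with all coordinate projections and with the adjacency operator [D],
    so it is almost a diagonal operator whose entries vary slowly.  Vectors coming
    from [A] are fixed by [h], hence live essentially where the diagonal exceeds
    [1 / 2]; those coming from [B] are killed by [h], hence live essentially where
    it is below [1 / 4].  These two regions of [X] are more than [r] apart, and
    the quasi-locality of [a] applies to them. *)
Lemma conj_op_quasi_local (R : realType) (X Y : metricType R) (U : unitary R X Y)
    (a : bop R X) :
  unif_locally_finite X -> unif_locally_finite Y ->
  (forall b, uniform_roe X b -> uniform_roe Y (conj_op U b)) ->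
  quasi_local X a -> quasi_local Y (conj_op U a).
Proof.
move=> ulfX ulfY roeU aql e0 e00.
set V := uinv U.
have e02 : 0 < e0 / 2 by rewrite divr_gt0.
have [r r0 aP] := aql _ e02.
have [D DE] := adjacency_exists (r + 1) ulfX.
have DR : uniform_roe X D.
  apply/finite_propagation_roe/finite_propagationP; exists (r + 1).
    by rewrite addr_ge0// ltW.
  move=> x y; rewrite DE; case: ltP => [/ltW//|_]; by rewrite eqxx.
have DN := opnorm_ge0 D; have AN := opnorm_ge0 a.
(* The three bounds serve [fixed_vector_support], the separation of the two
   regions of [X], and the two error terms of the final estimate. *)
pose eps : R := Num.min (1 / 16) (Num.min (1 / (16 * (opnorm D + 1))) (e0 / (32 * (opnorm a + 1)))).
have eps0 : 0 < eps.
  by rewrite !lt_min !divr_gt0// mulr_gt0// ltr_wpDl.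
have eps1 : eps <= 1 / 16 by rewrite ge_min lexx.
have eps2 : 2 * eps * opnorm D <= 1 / 8.
  have : eps <= 1 / (16 * (opnorm D + 1)) by rewrite !ge_min lexx orbT.
  rewrite ler_pdivlMr; last by rewrite mulr_gt0// ltr_wpDl.
  by move: eps0 DN; clear; move: eps (opnorm D) => *; nra.
have eps3 : 16 * eps * opnorm a <= e0 / 2.
  have : eps <= e0 / (32 * (opnorm a + 1)) by rewrite !ge_min lexx !orbT.
  rewrite ler_pdivlMr; last by rewrite mulr_gt0// ltr_wpDl.
  by move: eps0 AN; clear; move: eps (opnorm a) => *; nra.
have eta0 : 0 < 1 / 16 :> R by rewrite divr_gt0.
have [d1 d10 d1P] := roe_commutes_lip ulfY (roeU _ DR) eta0.
have [d2 d20 d2P] := chi_commutes_lip ulfY (fun S => roeU _ (chi_roe S)) eps0.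
pose d := Num.min d1 d2.
have d0 : 0 < d by rewrite lt_min d10.
exists d^-1; first by rewrite invr_gt0.
move=> A B AB.
have [m [mlip mA mB]] := lip_mult_separates d0 AB.
have {}d1P := d1P m (lip_mult_mono (_ : d <= d1) mlip).
have {}d2P := d2P m (lip_mult_mono (_ : d <= d2) mlip).
have {}d1P : forall u, l2norm (m (conj_op U D u) - conj_op U D (m u)) <= 1 / 16 * l2norm u.
  by apply: d1P; rewrite ge_min lexx.
have {}d2P : forall S u, l2norm (m (conj_op U (chi R S) u) - conj_op U (chi R S) (m u))
    <= eps * l2norm u.
  by apply: d2P; rewrite ge_min lexx orbT.
pose h := conj_op (unitary_inv U) m.
have hE u : h u = V (m (U u)) by [].
have h_chi S u : l2norm (h (chi R S u) - chi R S (h u)) <= eps * l2norm u.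
  rewrite !hE -[chi R S (V _)](ufunK U) -uinvB l2norm_uinv.
  by have := d2P S (U u); rewrite !conj_opE ufunK l2norm_ufun.
have h_D u : l2norm (h (D u) - D (h u)) <= 1 / 16 * l2norm u.
  rewrite !hE -[D (V _)](ufunK U) -uinvB l2norm_uinv.
  by have := d1P (U u); rewrite !conj_opE ufunK l2norm_ufun.
(* The gap [1 / 4] between the thresholds exceeds the variation of the diagonal
   along [D], which is at most [1 / 8 + 1 / 16]. *)
pose Nhi := [set x | l2norm (h (delta R x)) <= 1 / 2].
pose Nlo := [set x | 1 / 4 <= l2norm (h (delta R x))].
have hilo : (r%:E < setdist (~` Nhi) (~` Nlo))%E.
  apply: (@lt_le_trans _ _ (r + 1)%:E); first by rewrite lte_fin ltrDl.
  apply: le_ereal_inf_tmp => _ [[x y] [/= xhi ylo] <-]; rewrite lee_fin leNgt.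
  apply/negP => xy; have Dyx : D (delta R y) x = 1.
    by rewrite DE metric_sym xy.
  have := diagonal_variation h_chi Dyx h_D.
  move/negP: xhi; move/negP: ylo; rewrite -!ltNge.
  by move: eps2; clear; move: (l2norm _) (l2norm _) => *; lra.
(* This is the adjoint of the estimate of [fixed_vector_support]: [V chi_A U] is
   an orthogonal projection, so the cut-off may be moved to its other side. *)
have cutA w : l2norm (chi R A (U (chi R Nhi w))) <= 8 * eps * l2norm w.
  set z := chi R A _.
  have Az : chi R A z = z by rewrite chi_chi setIid.
  have hz : h (V z) = V z by rewrite hE uinvK -Az mA.
  have := fixed_vector_support h_chi eps1 hz; rewrite -/Nhi l2norm_uinv => zle.
  have [z0|z0] := eqVneq (l2norm z) 0.
    by rewrite z0 !mulr_ge0 ?l2norm_ge0// ltW.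
  have zpos : 0 < l2norm z by rewrite lt_neqAle eq_sym z0 l2norm_ge0.
  rewrite -(ler_pM2r zpos) -expr2.
  have -> : l2norm z ^+ 2 = normc (inner w (chi R Nhi (V z))).
    rewrite -inner_chi -(inner_ufun U) uinvK -{2}Az -inner_chi -/z innerxx.
    by rewrite normc_real ger0_norm// sqr_ge0.
  apply: le_trans (CauchySchwarz _ _) _.
  by rewrite mulrAC mulrC; apply: ler_wpM2r => //; exact: l2norm_ge0.
apply: opnorm_le => [|v]; first exact: ltW.
rewrite 2!bopME conj_opE; set z := uinv U _.
have V0 : V 0 = 0 by rewrite /V -(subrr (0 : ell2 R Y)) uinvB subrr.
have hz : h z = 0 by rewrite hE uinvK mB V0.
have zv : l2norm z <= l2norm v by rewrite l2norm_uinv l2norm_chi_le.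
have zlo := kernel_vector_support h_chi eps1 hz; rewrite -/Nlo in zlo.
have mid := (opnorm_leP _ (ltW e02)).1 (aP _ _ hilo) z; rewrite 2!bopME in mid.
have az := l2norm_bop_le a z.
have lo1 : l2norm (chi R A (U (chi R (~` Nhi) (a (chi R Nlo z))))) <=
    opnorm a * (8 * eps * l2norm z).
  apply: le_trans (l2norm_chi_le _ _) _; rewrite l2norm_ufun.
  apply: le_trans (l2norm_chi_le _ _) _; apply: le_trans (l2norm_bop_le _ _) _.
  by rewrite ler_wpM2l.
have mid1 : l2norm (chi R A (U (chi R (~` Nhi) (a (chi R (~` Nlo) z))))) <=
    e0 / 2 * l2norm z.
  by apply: le_trans (l2norm_chi_le _ _) _; rewrite l2norm_ufun.
have hi1 : l2norm (chi R A (U (chi R Nhi (a z)))) <= 8 * eps * (opnorm a * l2norm z).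
  by apply: le_trans (cutA _) _; rewrite ler_wpM2l// mulr_ge0// ltW.
rewrite -[a z](chiD_compl Nhi) ufunD bopD.
rewrite -[in chi R (~` Nhi) _](chiD_compl Nlo z) bopD [chi R (~` Nhi) _]bopD ufunD bopD.
apply: le_trans (ler_l2normD _ _) _.
apply: le_trans (lerD hi1 (le_trans (ler_l2normD _ _) (lerD lo1 mid1))) _.
apply: (@le_trans _ _ (e0 * l2norm z)); last by rewrite ler_wpM2l// ltW.
have zn := l2norm_ge0 z; move: eps3 zn; clear.
move: (l2norm z) (opnorm a) => n k le n0.
rewrite -subr_ge0 (_ : _ - _ = (e0 / 2 - 16 * eps * k) * n); last by field.
by rewrite mulr_ge0// subr_ge0.
Qed.

(** * Isomorphisms of uniform Roe algebras are spatial *)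

Section SpatialImplementation.
Context {R : realType} {X Y : metricType R}.

Lemma rank_oneDl (w w' xi : ell2 R X) :
  rank_one (w + w') xi = rank_one w xi + rank_one w' xi.
Proof. by apply: bopP => u; rewrite bopDE !rank_oneE scalerDr. Qed.

Lemma rank_oneZl (z : R[i]) (w xi : ell2 R X) :
  rank_one (z *: w) xi = z *: rank_one w xi.
Proof. by apply: bopP => u; rewrite bopZE !rank_oneE !scalerA mulrC. Qed.

Lemma inner_delta_delta (x : X) : inner (delta R x) (delta R x) = 1.
Proof. by rewrite innerxx l2norm_delta expr1n. Qed.

Lemma delta_neq0 (T : choiceType) (x : T) : delta R x <> 0.
Proof.
move=> /(congr1 (fun u => l2norm u)); rewrite l2norm_delta l2norm0.
by move/eqP; rewrite oner_eq0.
Qed.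

Lemma uniform_roe0 : uniform_roe X 0.
Proof.
have <- : rank_one (0 : ell2 R X) 0 = 0.
  by apply: bopP => u; rewrite rank_oneE scaler0.
exact: rank_one_roe.
Qed.

End SpatialImplementation.

(** The left ideal of operators [rank_one u d0] is a copy of the Hilbert space
    inside the uniform Roe algebra, on which the algebra acts as it does on
    vectors and on which [adjoint (rank_one u d0) * rank_one v d0] recovers the
    inner product.  Evaluating the images of these operators at a unit vector [xi]
    fixed by the projection [Phi (rank_one d0 d0)] transports all this structure;
    surjectivity holds because the operators [rank_one w xi] are in the range of
    [Phi].  If [X] is empty, then so is [Y]. *)
Lemma roe_isomorphism_spatial (R : realType) (X Y : metricType R)
    (Phi : bop R X -> bop R Y) :
  star_isomorphism (uniform_roe X) (uniform_roe Y) Phi ->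
  exists U : unitary R X Y, forall a, uniform_roe X a -> conj_op U a = Phi a.
Proof.
move=> [[PhiR Phi_inj Phi_surj] PhiD PhiZ PhiM PhiA].
have Phi0 : Phi 0 = 0.
  apply: (addrI (Phi 0)); rewrite -PhiD ?addr0//; exact: uniform_roe0.
have [[x0 _]|noX] := pselect (exists x : X, True); last first.
  have X0 (u v : ell2 R X) : u = v.
    by apply: ell2P => x; exfalso; apply: noX; exists x.
  have noY (y : Y) : False.
    have [a _ aE] := Phi_surj _ (rank_one_roe (delta R y) (delta R y)).
    have a0 : a = 0 by apply: bopP => u; exact: X0.
    apply: (@delta_neq0 R _ y).
    have := rank_oneE (delta R y) (delta R y) (delta R y).
    by rewrite -aE a0 Phi0 bop0E inner_delta_delta scale1r => <-.
  have Y0 (u v : ell2 R Y) : u = v by apply: ell2P => y; case: (noY y).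
  pose T (u : ell2 R X) : ell2 R Y := 0; pose V (u : ell2 R Y) : ell2 R X := 0.
  have Tin u v : inner (T u) (T v) = inner u v.
    by rewrite (X0 u 0) !inner0l.
  exists (@Unitary R X Y T V (fun _ _ => Y0 _ _) (fun _ _ => Y0 _ _) Tin
            (fun _ => X0 _ _) (fun _ => Y0 _ _)).
  by move=> a _; apply: bopP => u; exact: Y0.
pose d0 := delta R x0; pose e := rank_one d0 d0.
have eR : uniform_roe X e by exact: rank_one_roe.
have ee : e * e = e by rewrite rank_oneM inner_delta_delta scale1r.
have [eta peta] : exists eta, Phi e eta <> 0.
  apply: contrapT => no; apply: (@delta_neq0 R _ x0).
  have e0 : e = 0.
    apply: Phi_inj; [exact/mem_set|exact/mem_set/uniform_roe0|].
    rewrite Phi0; apply: bopP => u; rewrite bop0E; apply: contrapT => pu.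
    by apply: no; exists u.
  by have := rank_oneE d0 d0 d0; rewrite -/e e0 bop0E inner_delta_delta scale1r.
pose n := l2norm (Phi e eta).
have n0 : n != 0 by apply/eqP => /l2norm_eq0.
pose xi := (n^-1)%:C%C *: Phi e eta.
have pxi : Phi e xi = xi by rewrite bopZ -bopME -PhiM// ee.
have xixi : inner xi xi = 1.
  rewrite innerxx l2normZ normc_real -/n ger0_norm ?invr_ge0 ?l2norm_ge0//.
  by rewrite mulVf// expr1n.
have roeT u : uniform_roe X (rank_one u d0) by exact: rank_one_roe.
pose T u := Phi (rank_one u d0) xi.
have TD u v : T (u + v) = T u + T v.
  by rewrite /T rank_oneDl (PhiD _ _ (roeT u) (roeT v)) bopDE.
have TZ (z : R[i]) u : T (z *: u) = z *: T u.
  by rewrite /T rank_oneZl (PhiZ z _ (roeT u)) bopZE.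
have Tinner u v : inner (T u) (T v) = inner u v.
  rewrite /T adjointP -(PhiA _ (roeT u)) adjoint_rank_one -bopME.
  rewrite -(PhiM _ _ (rank_one_roe d0 u) (roeT v)).
  by rewrite rank_oneM (PhiZ _ _ eR) bopZE pxi innerZr xixi mulr1 -innerC.
have Tsurj w : exists u, T u = w.
  have [b bR bE] := Phi_surj _ (rank_one_roe w xi).
  exists (b d0); rewrite /T -bop_rank_one (PhiM _ _ bR eR) bopME pxi bE rank_oneE.
  by rewrite xixi scale1r.
have [V TV] := choice Tsurj.
have Tinj u v : T u = T v -> u = v.
  move=> Tuv; apply/eqP; rewrite -subr_eq0; apply/eqP/l2norm_eq0.
  have Tuv0 : T (u - v) = 0.
    by rewrite -scaleN1r TD TZ Tuv scaleN1r subrr.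
  have := Tinner (u - v) (u - v); rewrite Tuv0 inner0l innerxx.
  by move=> /(congr1 (@complex.Re R)) /= /esym/eqP; rewrite sqrf_eq0 => /eqP.
have VT : cancel T V by move=> u; apply: Tinj; rewrite TV.
exists (@Unitary R X Y T V TD TZ Tinner VT TV) => a aR.
apply: bopP => w; rewrite conj_opE /= -[in RHS](TV w) /T -bop_rank_one.
by rewrite (PhiM _ _ aR (roeT _)) bopME.
Qed.

Theorem theorem1p3 (R : realType) (X Y : metricType R)
    (ulfX : unif_locally_finite X) (ulfY : unif_locally_finite Y)
    (Phi : bop R X -> bop R Y)
    (isoPhi : star_isomorphism (uniform_roe X) (uniform_roe Y) Phi) :
  exists Psi : bop R X -> bop R Y,
    star_isomorphism (quasi_local X) (quasi_local Y) Psi /\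
    forall a : bop R X, uniform_roe X a -> Psi a = Phi a.
Proof.
have [U UE] := roe_isomorphism_spatial isoPhi.
have [[PhiR _ Phi_surj] _ _ _ _] := isoPhi.
have UX a : uniform_roe X a -> uniform_roe Y (conj_op U a).
  by move=> aR; rewrite UE//; exact: PhiR.
have UY b : uniform_roe Y b -> uniform_roe X (conj_op (unitary_inv U) b).
  by move=> /Phi_surj[a aR <-]; rewrite -(UE a aR) (conj_opK U a).
exists (conj_op U); split; last exact: UE.
split.
- split.
  + by move=> a aq; exact: conj_op_quasi_local aq.
  + by move=> a b _ _ /(congr1 (conj_op (unitary_inv U))); rewrite (conj_opK U a) (conj_opK U b).
  + move=> b bq; exists (conj_op (unitary_inv U) b).
      exact: conj_op_quasi_local bq.
    by apply: bopP => u; rewrite !conj_opE /= !uinvK.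
- by move=> a b _ _; exact: conj_opD.
- by move=> c a _; exact: conj_opZ.
- by move=> a b _ _; exact: conj_opM.
- by move=> a _; exact: conj_op_adjoint.
Qed.
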